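(* Every non-singular legal double hexagon tiling is aperiodic, i.e. it is invariant under no non-zero translation of the plane.
   Context: Well-arrowed hexagons. An arrowed hexagon is a regular hexagon each of whose sides carries a direction (an arrow). It is well-arrowed if its sides can be labelled $e_0,\dots,e_5$ in counterclockwise order so that the arrows on $e_0,e_1,e_4$ run counterclockwise around the hexagon and those on $e_2,e_3,e_5$ run clockwise. Thus the arrows on the opposite sides $e_0,e_3$ are parallel and point in the same direction (this direction is the orientation of the hexagon), while those on $e_1,e_2$ point to their common vertex, and likewise those on $e_4,e_5$. Three alternate sides are of mixed type if their arrows are not all counterclockwise and not all clockwise; if three alternate sides of a hexagon carry arrows of mixed type there is exactly one way to arrow the other three sides so that the hexagon is well-arrowed. An edge-to-edge tiling of the plane by congruent well-arrowed regular hexagons is well-matched if on every common edge the arrows of the two adjacent hexagons coincide. Double hexagon tiles. A double hexagon tile is a well-arrowed (outer, or large) hexagon containing a concentric well-arrowed (inner) hexagon of one third the area, rotated by $90^\circ$ (equivalently $30^\circ$) relative to the outer one as a shape, whose orientation is at right angles to the orientation of the outer one. In an edge-to-edge tiling of the plane by double hexagon tiles (with the outer hexagons as tiles), at every vertex $v$ the three edges, one from each of the three inner hexagons in the tiles at $v$, that are closest to $v$ are three alternate edges of a regular hexagon centred at $v$, called a corner hexagon. The inner hexagons together with the corner hexagons (the small hexagons) form a hexagonal tiling of the plane. The tiling by double hexagons is legal if: its outer hexagons are well-matched; at each corner hexagon the three arrows coming from the inner hexagons are of mixed type (so the corner hexagon is completed uniquely to a well-arrowed one); and the resulting arrowed tiling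 by small hexagons is well-matched. Black markings. Fix a small $\varepsilon>0$. In a well-arrowed hexagon with sides labelled $e_0,\dots,e_5$ in counterclockwise order so that the arrows on $e_0,e_1,e_4$ run counterclockwise around the hexagon and those on $e_2,e_3,e_5$ run clockwise, mark on each side the point at distance $\varepsilon$ from its midpoint in the direction of the arrow. The stripe is the straight segment joining the marked points on $e_0$ and $e_3$. The two corner markings are the two bent lines with a $60^\circ$ angle that join the marked points of $e_1,e_2$, respectively of $e_4,e_5$, and consist of two segments perpendicular to the sides at the marked points. In a well-matched tiling these markings join to continuous paths. Non-singularity. A legal double hexagon tiling is non-singular if every path formed by the black markings of its small hexagons is the boundary of an equilateral triangle (there is no path extending infinitely in some direction). *)

(* Defs.v *)
From HB Require Import structures.
From mathcomp Require Import all_boot all_order all_algebra.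
From mathcomp Require Import complex.
From mathcomp Require Import boolp classical_sets reals.
From Stdlib Require Import Relations.Relation_Operators.

Set Implicit Arguments.
Unset Strict Implicit.
Unset Printing Implicit Defensive.

Import Order.TTheory GRing.Theory Num.Theory.

Local Open Scope classical_set_scope.
Local Open Scope complex_scope.
Local Open Scope ring_scope.

(* The Euclidean plane is the complex plane R[i]: translations are additions,
   and a counterclockwise rotation by 60 degrees about 0 is multiplication
   by [zeta]. *)

Section Plane.
Variable R : realType.
Implicit Types (p q u v z : R[i]).

Definition dot u v : R := complex.Re u * complex.Re v + complex.Im u * complex.Im v.

(* Positive iff [v] points counterclockwise from [u]. *)
Definition cross u v : R := complex.Re u * complex.Im v - complex.Im u * complex.Re v.

Definition len v : R := Num.sqrt (dot v v).

Definition zeta : R[i] := (1 / 2%:R) +i* (Num.sqrt 3%:R / 2%:R).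

Definition segment p q : set R[i] :=
  [set z | exists t : R, [/\ 0 <= t, t <= 1 & z = p + t%:C * (q - p)]].

Definition equilateral_triangle_boundary (A : set R[i]) : Prop :=
  exists a b c : R[i],
    [/\ a != b, len (b - a) = len (c - b), len (c - b) = len (a - c) &
        A = segment a b `|` segment b c `|` segment c a].

End Plane.

(* A well-arrowed hexagon with its sides labelled e_0, ..., e_5 as in the
   definition of well-arrowed.  It is given by its centre and the vector from
   the centre to the first endpoint of e_0 (in counterclockwise order); the
   vertices are v_k = centre + spoke * zeta ^+ k, and e_k runs from v_k to
   v_{k+1}.  As no non-trivial rotation of the hexagon preserves the pattern of
   arrows, the labelling is unique, so that distinct records (with non-zero
   spoke) are distinct arrowed hexagons. *)
Record hexagon (R : realType) := Hexagon { centre : R[i]; spoke : R[i] }.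

Section Hexagons.
Variable R : realType.
Implicit Types (h : hexagon R) (v z : R[i]).

Definition vertex h (k : nat) : R[i] := centre h + spoke h * zeta R ^+ k.

Definition side h (k : nat) : set (R[i]) := segment (vertex h k) (vertex h k.+1).

Definition region h : set (R[i]) :=
  [set z | exists l : 'I_6 -> R,
     [/\ forall k, 0 <= l k, \sum_(k < 6) l k = 1 &
         z = \sum_(k < 6) (l k)%:C * vertex h k]].

(* The arrow on e_k, as the pair (tail, head); it runs counterclockwise
   around the hexagon exactly for k = 0, 1, 4. *)
Definition arrow h (k : 'I_6) : R[i] * R[i] :=
  if (k : nat) \in [:: 0; 1; 4]%N then (vertex h k, vertex h k.+1)
  else (vertex h k.+1, vertex h k).

Definition arrow_vector h (k : 'I_6) : R[i] := (arrow h k).2 - (arrow h k).1.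

(* The common direction of the parallel arrows on e_0 and e_3. *)
Definition orientation h : R[i] := arrow_vector h ord0.

Definition well_matched (S : set (hexagon R)) : Prop :=
  forall h h', S h -> S h' -> forall k k' : 'I_6,
    side h k = side h' k' -> arrow h k = arrow h' k'.

Definition translate_hexagon z h : hexagon R := Hexagon (centre h + z) (spoke h).

(* Tiles of an arbitrary type [I], the shape of a tile [t] being that of the
   hexagon [hex t].  Two different tiles meet in nothing, in a common vertex or
   in a common side. *)
Definition edge_to_edge_tiling (I : Type) (hex : I -> hexagon R) (T : set I) :
    Prop :=
  [/\ exists2 s : R, 0 < s & forall t, T t -> len (spoke (hex t)) = s,
      forall z, exists2 t, T t & region (hex t) z &
      forall t t', T t -> T t' -> t <> t' ->
        let A := region (hex t) `&` region (hex t') in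
        [\/ A = set0,
            exists k k' : 'I_6, vertex (hex t) k = vertex (hex t') k' /\
              A = [set vertex (hex t) k] |
            exists k k' : 'I_6, side (hex t) k = side (hex t') k' /\
              A = side (hex t) k]].

End Hexagons.

Record double_hexagon (R : realType) :=
  DoubleHexagon { outer : hexagon R; inner : hexagon R }.

Section DoubleHexagons.
Variable R : realType.
Implicit Types (t : double_hexagon R) (T : set (double_hexagon R)).
Implicit Types (h : hexagon R) (v z : R[i]).

(* One third of the area means that the sides are in the ratio 1 : sqrt 3.  The
   second clause says that the inner hexagon, scaled up by sqrt 3 and with its
   arrows forgotten, is the outer one rotated by 90 degrees. *)
Definition is_double_hexagon t : Prop :=
  [/\ centre (inner t) = centre (outer t),
      exists k : 'I_6, (Num.sqrt 3%:R)%:C * spoke (inner t) =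
                         'i%C * spoke (outer t) * zeta R ^+ k &
      dot (orientation (inner t)) (orientation (outer t)) = 0].

Definition double_hexagon_tiling T : Prop :=
  (forall t, T t -> is_double_hexagon t) /\ edge_to_edge_tiling (@outer R) T.

(* No side of [h] is at a smaller distance from [v] than e_k. *)
Definition closest_side h (k : 'I_6) v : Prop :=
  forall (j : 'I_6) z, side h j z ->
    exists2 z', side h k z' & len (z' - v) <= len (z - v).

Definition tiling_vertex T v : Prop :=
  exists2 t, T t & exists k : 'I_6, vertex (outer t) k = v.

(* The arrows that the corner hexagon at the vertex [v] receives from the inner
   hexagons of the tiles at [v]. *)
Definition corner_arrow T v (a : R[i] * R[i]) : Prop :=
  exists t, [/\ T t, exists k : 'I_6, vertex (outer t) k = v &
    exists2 k : 'I_6, closest_side (inner t) k v & a = arrow (inner t) k].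

Definition mixed_corner T v : Prop :=
  ~ (forall a, corner_arrow T v a -> 0 < cross (a.1 - v) (a.2 - v)) /\
  ~ (forall a, corner_arrow T v a -> cross (a.1 - v) (a.2 - v) < 0).

(* The corner hexagon, completed to a well-arrowed one. *)
Definition corner_hexagon T h : Prop :=
  tiling_vertex T (centre h) /\
  forall a, corner_arrow T (centre h) a -> exists k : 'I_6, arrow h k = a.

Definition small_hexagon T : set (hexagon R) :=
  [set h | (exists2 t, T t & h = inner t) \/ corner_hexagon T h].

Definition legal T : Prop :=
  [/\ double_hexagon_tiling T,
      well_matched (@outer R @` T),
      forall v, tiling_vertex T v -> mixed_corner T v &
      well_matched (small_hexagon T)].

Definition translate_double_hexagon z t : double_hexagon R :=
  DoubleHexagon (translate_hexagon z (outer t)) (translate_hexagon z (inner t)).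

Definition aperiodic T : Prop :=
  forall z, translate_double_hexagon z @` T = T -> z = 0.

End DoubleHexagons.

Variant marking_kind := Stripe | Corner12 | Corner45.

Section BlackMarkings.
Variables (R : realType) (eps : R).
Implicit Types (h : hexagon R) (T : set (double_hexagon R)).

Definition marked_point h (k : 'I_6) : R[i] :=
  (vertex h k + vertex h k.+1) / 2%:R
  + (eps / len (arrow_vector h k))%:C * arrow_vector h k.

(* The bent line from the marked point of e_k to that of e_l, made of two
   segments perpendicular to these sides; [b] is the point where it bends. *)
Definition corner_marking h (k l : 'I_6) : set (R[i]) :=
  [set z | exists b : R[i],
     [/\ dot (b - marked_point h k) (arrow_vector h k) = 0,
         dot (b - marked_point h l) (arrow_vector h l) = 0 &
         (segment (marked_point h k) b `|` segment b (marked_point h l)) z]].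

Definition marking_sides (j : marking_kind) : 'I_6 * 'I_6 :=
  match j with
  | Stripe => (inord 0, inord 3)
  | Corner12 => (inord 1, inord 2)
  | Corner45 => (inord 4, inord 5)
  end.

Definition marking (m : hexagon R * marking_kind) : set (R[i]) :=
  let: (k, l) := marking_sides m.2 in
  if m.2 is Stripe then segment (marked_point m.1 k) (marked_point m.1 l)
  else corner_marking m.1 k l.

Definition marking_ends (m : hexagon R * marking_kind) : set (R[i]) :=
  let: (k, l) := marking_sides m.2 in
  [set marked_point m.1 k; marked_point m.1 l].

Definition joined T (m m' : hexagon R * marking_kind) : Prop :=
  [/\ small_hexagon T m.1, small_hexagon T m'.1 &
      marking_ends m `&` marking_ends m' !=set0].

(* The path formed by all the markings that are successively joined to [m]. *)
Definition marking_path T (m : hexagon R * marking_kind) : set (R[i]) :=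
  [set z | exists2 m', clos_refl_trans _ (joined T) m m' & marking m' z].

Definition non_singular T : Prop :=
  forall m, small_hexagon T m.1 ->
    equilateral_triangle_boundary (marking_path T m).

End BlackMarkings.

(* Main.v *)
Require Import Defs.
From mathcomp Require Import all_boot all_order all_algebra.
From mathcomp Require Import complex.
From mathcomp Require Import boolp classical_sets reals.
From mathcomp Require Import zify ring lra.

Set Implicit Arguments.
Unset Strict Implicit.
Unset Printing Implicit Defensive.

Import Order.TTheory GRing.Theory Num.Theory.

Local Open Scope complex_scope.
Local Open Scope ring_scope.

(** A small hexagon is remembered by its centre, a point of a triangular
    lattice, and by the direction of its stripe, one of the three directions of
    lines through adjacent centres.  Follow such a line, of direction [u], and
    look at the arrows on the sides that it crosses.  In a hexagon whose stripe
    lies along the line, the two arrows on the crossed sides are parallel: the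
    arrow is handed on unchanged.  In any other hexagon they are antiparallel,
    and which of the two possible ways occurs is decided by the direction of the
    stripe.  So well-matchedness says this: after deletion of the hexagons with
    stripe along the line, the two other directions alternate
    ([arrows_alternate]).  The same holds for the outer hexagons.  Their centres
    form one coset of a sublattice of index 3, and their stripes are
    perpendicular to those of the inner hexagons; hence within that coset the
    same alternation holds along the three perpendicular directions.  Altogether
    the tiling gives an [alternating_colouring] of the lattice by the three
    stripe directions ([small_alternating]), and a translation that preserves
    the tiling preserves the colouring ([colour_period]).

    An alternating colouring has no non-zero period ([colouring_aperiodic]).
    Comparing nearby points shows that every point is either even, when the
    stripes at its six neighbours all point to it, or odd, when the four
    neighbours off its own stripe have a prescribed colour ([even_or_odd]).  If
    [x] is even then so is every [x + y *+ 2], and no other point is.  A period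
    therefore has the form [z *+ 2].  An odd point halfway between two even
    points has precisely the colour that is deleted on the line through them;
    thus the even points, rescaled by [1/2], again carry an alternating
    colouring, of which [z] is a period ([coarse_colouring]).  By infinite
    descent the period is zero.

    The geometry consists in putting a tiling by congruent regular hexagons on a
    lattice.  Tiles do not accumulate, because the centre of a tile lies in no
    other tile, and they are closed; so some tile contains the midpoint of a
    given side of a tile [t] and points beyond it, and its shape has to be the
    mirror image of that of [t] in this side ([tile_across_side]).  The tiles
    obtained in this way sit on a lattice and cover the plane, so there are no
    others ([tile_has_site]).  A corner hexagon exists at each vertex because
    three alternate arrows of mixed type extend to a well-arrowed hexagon
    ([small_hexagon_at]). *)

(** * Colourings of the triangular lattice *)

(** The pair [(a, b)] stands for the point [a + b * zeta], [zeta] a primitive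
    sixth root of unity. *)
Notation lattice := (int * int)%type.

(** [zeta ^+ m] in coordinates. *)
Definition unit_vector (m : nat) : lattice :=
  nth 0 [:: (1, 0); (0, 1); (-1, 1); (-1, 0); (0, -1); (1, -1)] (m %% 6)%N.

(** A vector of length [sqrt 3] perpendicular to [unit_vector m]. *)
Definition normal_vector (m : nat) : lattice :=
  unit_vector (m + 1) + unit_vector (m + 2).

(** The three classes are the cosets of the sublattice [(1 + zeta) * Z[zeta]],
    which is spanned by the normal vectors. *)
Definition in_class (c : int) (x : lattice) : bool := (3 %| x.1 - x.2 - c)%Z.

(* Directions have period 6, so identities between them are checked case by case. *)
Ltac hexagon_cases m :=
  rewrite /normal_vector /unit_vector;
  rewrite -?addnA; do ?rewrite -(modnDml m);
  case: (m %% 6)%N (ltn_pmod m (isT : 0 < 6)%N) => [|[|[|[|[|[|]]]]]] //= _.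

Ltac shift m := rewrite -?addrA; congr (_ + _); hexagon_cases m.

Section Colourings.
Implicit Types (x y z v : lattice) (c : int) (d : lattice -> nat) (u w n m : nat).

(** Among the points of the line through [x] in direction [v] whose colour is not
    [u], two consecutive ones, the first of them being [x], differ in colour. *)
Definition alternating d x v u : Prop := forall w n, w != u -> (0 < n)%N ->
  d x = w -> (forall i, (0 < i < n)%N -> d (x + v *+ i) = u) ->
  d (x + v *+ n) != w.

(** Colour [k] stands for a stripe along [unit_vector k], which is also the line of
    [unit_vector (k + 3)]; this is why colours are compared with [m %% 3]. *)
Definition alternating_colouring c d : Prop :=
  [/\ forall x, (d x < 3)%N,
      forall x m, alternating d x (unit_vector m) (m %% 3) &
      forall x m, in_class c x -> alternating d x (normal_vector m) (m %% 3)].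

Definition even_point d x : Prop := forall m, d (x + unit_vector m) = (m %% 3)%N.

(** The sum [3 = 0 + 1 + 2] says that the neighbour has the third colour. *)
Definition odd_point d x : Prop :=
  forall m, (m %% 3)%N != d x -> (d (x + unit_vector m)%R + m %% 3 + d x = 3)%N.

Lemma unit_vector_mod m k : m = k %[mod 6] -> unit_vector m = unit_vector k.
Proof. by rewrite /unit_vector => ->. Qed.

Lemma unit_vector_inj m n : unit_vector m = unit_vector n -> m = n %[mod 6].
Proof.
rewrite /unit_vector.
case: (m %% 6)%N (ltn_pmod m (isT : 0 < 6)%N) => [|[|[|[|[|[|]]]]]] // _;
by case: (n %% 6)%N (ltn_pmod n (isT : 0 < 6)%N) => [|[|[|[|[|[|]]]]]].
Qed.

Lemma unit_vectorN m : unit_vector (m + 3) = - unit_vector m.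
Proof. by hexagon_cases m. Qed.

Lemma unit_vectorD m : unit_vector m + unit_vector (m + 2) = unit_vector (m + 1).
Proof. by hexagon_cases m. Qed.

Lemma in_class_unit c x m : in_class c (x + unit_vector m) =
  (3 %| x.1 - x.2 - c + (if odd m then -1 else 1))%Z.
Proof.
have -> : odd m = odd (m %% 6) by rewrite [in LHS](divn_eq m 6) oddD oddM andbF.
rewrite /in_class; hexagon_cases m; lia.
Qed.

Lemma in_class_near c x m :
  [\/ in_class c x, in_class c (x + unit_vector m) |
      in_class c (x + unit_vector (m + 1))].
Proof.
suff : [|| in_class c x, in_class c (x + unit_vector m) |
           in_class c (x + unit_vector (m + 1))] by apply/or3P.
rewrite !in_class_unit oddD /in_class; case: (odd m) => /=; lia.
Qed.

Lemma in_classD c x m : in_class c (x + normal_vector m) = in_class c x.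
Proof. rewrite /in_class; hexagon_cases m; lia. Qed.

Section Local.
Variables (c : int) (d : lattice -> nat).
Hypothesis col : alternating_colouring c d.

Lemma colour_lt3 x : (d x < 3)%N. Proof. by case: col. Qed.

Lemma near_unit x y m :
  y = x + unit_vector m -> d x = d y -> d x = (m %% 3)%N.
Proof.
case: col => _ /(_ x m) alt _ -> E; apply/eqP/negPn/negP => dx.
have := alt (d x) 1%N dx isT erefl; rewrite mulr1n -E eqxx => H.
suff /H : forall i, (0 < i < 1)%N -> d (x + unit_vector m *+ i) = (m %% 3)%N by [].
by case=> // i; rewrite ltnS ltn0.
Qed.

Lemma near_normal x y m :
  in_class c x -> y = x + normal_vector m -> d x = d y -> d x = (m %% 3)%N.
Proof.
case: col => _ _ /(_ x m) alt /alt{}alt -> E; apply/eqP/negPn/negP => dx.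
have := alt (d x) 1%N dx isT erefl; rewrite mulr1n -E eqxx => H.
suff /H : forall i, (0 < i < 1)%N -> d (x + normal_vector m *+ i) = (m %% 3)%N by [].
by case=> // i; rewrite ltnS ltn0.
Qed.

(** The only configuration around [x], up to a half-turn, that the lines through
    adjacent points allow although it is neither even nor odd.  It is here that
    the perpendicular directions enter, in a way that depends on which of [x] and
    two of its neighbours lies in the class [c]. *)
Lemma no_mixed_point x m : d x = (m %% 3)%N ->
  d (x + unit_vector (m + 1)) = ((m + 1) %% 3)%N ->
  d (x + unit_vector (m + 2)) = ((m + 2) %% 3)%N ->
  d (x + unit_vector (m + 4)) = ((m + 2) %% 3)%N ->
  d (x + unit_vector (m + 5)) = ((m + 1) %% 3)%N -> False.
Proof.
move=> d0 d1 d2 d4 d5.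
case: (in_class_near c x (m + 1)) => [x0|x1|x2].
(* The points [x], [y] and [z] form a triangle of side [sqrt 3] in the class. *)
- set y := x + unit_vector m + unit_vector (m + 1).
  set z := x + unit_vector m + unit_vector (m + 5).
  have dy : d y = ((m + 2) %% 3)%N.
    have dx_y : d x = d y -> d x = ((m + 5) %% 3)%N.
      by apply: near_normal => //; rewrite /y; shift m.
    have dx1_y : d (x + unit_vector (m + 1)) = d y ->
        d (x + unit_vector (m + 1)) = (m %% 3)%N.
      by apply: near_unit; rewrite /y; shift m.
    move: (colour_lt3 y) dx_y dx1_y; rewrite d0 d1; lia.
  have dz : d z = ((m + 2) %% 3)%N.
    have dx_z : d x = d z -> d x = ((m + 4) %% 3)%N.
      by apply: near_normal => //; rewrite /z; shift m.
    have dx5_z : d (x + unit_vector (m + 5)) = d z ->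
        d (x + unit_vector (m + 5)) = (m %% 3)%N.
      by apply: near_unit; rewrite /z; shift m.
    move: (colour_lt3 z) dx_z dx5_z; rewrite d0 d5; lia.
  have : d z = d y -> d z = (m %% 3)%N.
    apply: near_normal; last by rewrite /y /z; shift m.
    have -> : z = x + normal_vector (m + 4) by rewrite /z; shift m.
    by rewrite in_classD.
  rewrite dy dz; lia.
- have : d (x + unit_vector (m + 1)) = d (x + unit_vector (m + 5)) ->
      d (x + unit_vector (m + 1)) = ((m + 3) %% 3)%N.
    by apply: near_normal => //; shift m.
  rewrite d1 d5; lia.
- rewrite -addnA in x2.
  have : d (x + unit_vector (m + 2)) = d (x + unit_vector (m + 4)) ->
      d (x + unit_vector (m + 2)) = ((m + 3) %% 3)%N.
    by apply: near_normal => //; shift m.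
  rewrite d2 d4; lia.
Qed.

(** Number the neighbours of [x] by [a k], starting from the direction of its own
    stripe.  On either side of the stripe the two neighbours [a (k + 1)] and
    [a (k + 2)] have the two other colours, in one of two orders, since neither of
    them may agree with [x] or with the other.  If the orders on the two sides
    are both [up], the neighbours along the stripe are forced as well and [x] is
    even; if both are [down], it is odd; mixed orders are excluded. *)
Lemma even_or_odd x : even_point d x \/ odd_point d x.
Proof.
pose u := d x; have u3 : (u < 3)%N := colour_lt3 x.
pose a k := d (x + unit_vector (u + k)).
have a3 k : (a k < 3)%N by apply: colour_lt3.
have a0 k : a k = u -> u = ((u + k) %% 3)%N by move=> E; apply: near_unit.
have next k : a (k + 1)%N = a k -> a (k + 1)%N = ((u + k + 5) %% 3)%N.
  by apply: near_unit; rewrite !addnA; move: (u + k)%N => m; shift m.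
have wrap k : a (k + 6)%N = a k by rewrite /a addnA (@unit_vector_mod _ (u + k)) // modnDr.
have mixed k : (u = (u + k) %% 3 -> a (k + 1) = (u + k + 1) %% 3 ->
    a (k + 2) = (u + k + 2) %% 3 -> a (k + 4) = (u + k + 2) %% 3 ->
    a (k + 5) = (u + k + 1) %% 3 -> False)%N.
  by rewrite /a !addnA; apply: no_mixed_point.
have a_mod m : d (x + unit_vector m) = a ((m + 5 * u) %% 6)%N.
  rewrite /a (@unit_vector_mod m (u + (m + 5 * u) %% 6)) // modnDmr addnCA.
  by rewrite -mulSn mulnC addnC modnMDl.
have du : d x = u by [].
clearbody u a.
pose up k := (a (k + 1) = (u + 1) %% 3 /\ a (k + 2) = (u + 2) %% 3)%N.
pose down k := (a (k + 1) = (u + 2) %% 3 /\ a (k + 2) = (u + 1) %% 3)%N.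
have pair k : (k %% 3 = 0)%N -> up k \/ down k.
  move=> k3; have := next (k + 1)%N; rewrite -addnA /up /down.
  have := a0 (k + 1)%N; have := a0 (k + 2)%N.
  move: (a3 (k + 1)%N) (a3 (k + 2)%N); move: (a (k + 1)%N) (a (k + 2)%N) => p q.
  clear - k3 u3; lia.
have not_mixed k : (k %% 3 = 0)%N -> up k -> down (k + 3)%N -> False.
  move=> k3 [a1 a2]; rewrite /down -!addnA => -[a4 a5].
  have {}mixed := mixed k; rewrite -[4%N]/(3 + 1)%N -[5%N]/(3 + 2)%N in mixed.
  by apply: mixed; clear - k3 u3 a1 a2 a4 a5; lia.
have middle k : (k %% 3 = 0)%N -> up k -> up (k + 3)%N -> a (k + 3)%N = u.
  move=> k3 [_ a2]; rewrite /up -!addnA => -[a4 _].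
  have := next (k + 2)%N; have := next (k + 3)%N; rewrite -!addnA a2 a4.
  rewrite -[(2 + 1)%N]/3%N.
  move: (a3 (k + 3)%N); move: (a (k + 3)%N) => p; clear - k3 u3; lia.
have wrap_up k : up k -> up (k + 6)%N.
  by rewrite /up -!addnA ![(6 + _)%N]addnC !addnA !wrap.
have wrap_down k : down k -> down (k + 6)%N.
  by rewrite /down -!addnA ![(6 + _)%N]addnC !addnA !wrap.
have [up0|down0] := pair 0%N erefl.
- have [up3|down3] := pair 3%N erefl; last by case: (not_mixed 0%N erefl).
  have a3u := middle 0%N erefl up0 up3.
  have a6u := middle 3%N erefl up3 (wrap_up 0%N up0).
  rewrite (wrap 0%N) in a6u; case: up0 up3 => [a1 a2] [a4 a5].
  left=> m; rewrite a_mod.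
  move: a6u a1 a2 a3u a4 a5.
  rewrite -[(0 + 3)%N]/3%N -[(0 + 1)%N]/1%N -[(0 + 2)%N]/2%N -[(3 + 1)%N]/4%N -[(3 + 2)%N]/5%N.
  have := ltn_pmod (m + 5 * u) (isT : 0 < 6)%N.
  have : ((m + 5 * u) %% 6 = (m + 5 * u) %[mod 3])%N by rewrite modn_dvdm.
  case: (_ %% 6)%N => [|[|[|[|[|[|]]]]]] // mu _ *;
    match goal with H : a _ = _ |- _ = _ => rewrite H end; clear - mu u3; lia.
- have [up3|down3] := pair 3%N erefl.
    by case: (not_mixed 3%N erefl up3 (wrap_down 0%N down0)).
  case: down0 down3 => [a1 a2] [a4 a5].
  right=> m; rewrite du a_mod; move: a1 a2 a4 a5.
  rewrite -[(0 + 1)%N]/1%N -[(0 + 2)%N]/2%N -[(3 + 1)%N]/4%N -[(3 + 2)%N]/5%N.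
  have := ltn_pmod (m + 5 * u) (isT : 0 < 6)%N.
  have : ((m + 5 * u) %% 6 = (m + 5 * u) %[mod 3])%N by rewrite modn_dvdm.
  case: (_ %% 6)%N => [|[|[|[|[|[|]]]]]] // mu _ a1 a2 a4 a5; rewrite ?a1 ?a2 ?a4 ?a5;
    clear - mu u3; lia.
Qed.

End Local.

(** [x] and [x + unit_vector m] have a common neighbour, whose stripe would have to
    point to both. *)
Lemma even_point_next d x m :
  even_point d x -> ~ even_point d (x + unit_vector m).
Proof.
move=> ev ev'; have := ev' (m + 2)%N; rewrite -addrA unit_vectorD ev; lia.
Qed.

(** At an odd point a neighbour whose stripe points to it lies on its own stripe,
    and the two neighbours here lie on different lines. *)
Lemma even_point_of_sides c d z m : alternating_colouring c d ->
  d (z + unit_vector (m + 2)) = ((m + 2) %% 3)%N ->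
  d (z + unit_vector (m + 4)) = ((m + 4) %% 3)%N ->
  even_point d z.
Proof.
move=> col E2 E4; have [//|od] := even_or_odd col z.
have z3 := colour_lt3 col z; have := od (m + 2)%N; have := od (m + 4)%N; rewrite E2 E4.
move: (d z) z3 => k k3.
by case: eqVneq => ? /=; case: eqVneq => ? /=; lia.
Qed.

(** The point in between is odd, and its neighbours off the line give the two
    neighbours of [x + unit_vector m *+ 2] to which [even_point_of_sides] applies. *)
Lemma even_point_double c d x m : alternating_colouring c d ->
  even_point d x -> even_point d (x + unit_vector m *+ 2).
Proof.
move=> col ev; have [/(even_point_next ev)//|od] := even_or_odd col (x + unit_vector m).
have side k : (k %% 3 != 0)%N ->
    (d (x + unit_vector m + unit_vector (m + k))%R + (m + k) %% 3 + m %% 3 = 3)%N.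
  by move=> k0; have := od (m + k)%N; rewrite ev; apply; lia.
apply: (@even_point_of_sides c d _ m) => //.
- have -> : x + unit_vector m *+ 2 + unit_vector (m + 2) = x + unit_vector m + unit_vector (m + 1).
    by rewrite mulr2n; shift m.
  have := side 1%N isT; lia.
- have -> : x + unit_vector m *+ 2 + unit_vector (m + 4) = x + unit_vector m + unit_vector (m + 5).
    by rewrite mulr2n; shift m.
  have := side 5%N isT; lia.
Qed.

Lemma even_point_exists c d : alternating_colouring c d -> exists x, even_point d x.
Proof.
move=> col; have [ev|od] := even_or_odd col 0; first by exists 0.
pose m := d 0; have m3 : (m < 3)%N := colour_lt3 col 0.
exists (0 + unit_vector m); apply: (@even_point_of_sides c d _ m) => //.
- have -> : 0 + unit_vector m + unit_vector (m + 2) = 0 + unit_vector (m + 1).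
    by rewrite -addrA unit_vectorD.
  have := od (m + 1)%N; rewrite -/m; clearbody m => E.
  have /E : ((m + 1) %% 3 != m)%N by lia.
  move: (d (0 + unit_vector (m + 1))) (m3); clear; lia.
- have -> : 0 + unit_vector m + unit_vector (m + 4) = 0 + unit_vector (m + 5).
    by shift m.
  have := od (m + 5)%N; rewrite -/m; clearbody m => E.
  have /E : ((m + 5) %% 3 != m)%N by lia.
  move: (d (0 + unit_vector (m + 5))) (m3); clear; lia.
Qed.

Lemma lattice_ind (P : lattice -> Prop) :
  P 0 -> (forall x m, P x -> P (x + unit_vector m)) -> forall x, P x.
Proof.
move=> P0 step [a b].
have steps x m n : P x -> P (x + unit_vector m *+ n).
  by move=> Px; elim: n => [|n IH]; rewrite ?mulr0n ?addr0 // mulrSr addrA; apply: step.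
have steps_int x m k : P x -> P (x + unit_vector m *~ k).
  case: k => n; first exact: steps.
  by rewrite NegzE mulrNz -mulNrz -unit_vectorN; apply: steps.
have -> : (a, b) = 0 + unit_vector 0 *~ a + unit_vector 1 *~ b :> lattice.
  rewrite /unit_vector /=; apply/eqP; rewrite add0r xpair_eqE /=.
  by rewrite !raddfMz /= !intz !mul0rz addr0 add0r !eqxx.
exact/steps_int/steps_int.
Qed.

Lemma even_point_translate c d x y : alternating_colouring c d ->
  even_point d x -> even_point d (x + y *+ 2).
Proof.
move=> col ev; elim/lattice_ind: y => [|y m IH]; first by rewrite mul0rn addr0.
by rewrite mulrnDl addrA; apply: even_point_double col IH.
Qed.

Lemma lattice_parity x : exists y, x = y *+ 2 \/ exists m, x = y *+ 2 + unit_vector m.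
Proof.
case: x => a b.
pose y : lattice := ((a %/ 2)%Z, (b %/ 2)%Z).
have : ((a %% 2)%Z, (b %% 2)%Z) \in ([:: (0, 0); (1, 0); (0, 1); (1, 1)] : seq lattice).
  by rewrite !inE !xpair_eqE; lia.
rewrite !inE !xpair_eqE => /or4P[] /andP[/eqP a2 /eqP b2].
- by exists y; left; congr (_, _); rewrite /= mulr2n; lia.
- by exists y; right; exists 0%N; congr (_, _); rewrite /= mulr2n; lia.
- by exists y; right; exists 1%N; apply/eqP; rewrite xpair_eqE /= !mulr2n; lia.
- exists (y + (1, 0)); right; exists 2%N; apply/eqP; rewrite xpair_eqE /= !mulr2n; lia.
Qed.

(** A period maps even points to even points. *)
Lemma period_double c d x z : alternating_colouring c d -> even_point d x ->
  (forall y, d (y + z) = d y) -> exists z', z = z' *+ 2.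
Proof.
move=> col ev per; have [y [->|[m zE]]] := lattice_parity z; first by exists y.
have /even_point_next : even_point d (x + y *+ 2).
  exact: even_point_translate col ev.
case/(_ m)=> k; rewrite -(addrA x) -zE addrAC per; exact: ev.
Qed.

(** A line of the coarse lattice is a line of the fine one with an odd point between
    any two consecutive points; as [v] is congruent to [unit_vector m] modulo 2,
    that odd point has colour [m %% 3] and is skipped by [alternating]. *)
Lemma coarse_alternating d x y v m :
    (forall z, even_point d (x + z *+ 2)) ->
    (exists z, v = unit_vector m + z *+ 2) ->
    alternating d (x + y *+ 2) v (m %% 3) ->
  alternating (fun y => d (x + y *+ 2)) y v (m %% 3).
Proof.
move=> ev [z vE] alt w n wm n0 dw between.
have step i : x + (y + v *+ i) *+ 2 = x + y *+ 2 + v *+ (i * 2).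
  by rewrite mulrnDl addrA mulrnA.
rewrite step; apply: alt => //; first by rewrite muln_gt0 n0.
move=> i i_n; have := odd_double_half i; rewrite -muln2; case: (odd i) => iE.
  have -> : x + y *+ 2 + v *+ i = x + (y + z + v *+ i./2) *+ 2 + unit_vector m.
    rewrite -[in LHS]iE mulrnDr mulr1n {1}vE !mulrnDl -mulrnA -!addrA.
    by do 3!congr (_ + _); rewrite addrC !addrA.
  exact: ev.
by rewrite -iE add0n -step between //; lia.
Qed.

Lemma coarse_colouring c d x : alternating_colouring c d -> even_point d x ->
  exists c', alternating_colouring c' (fun y => d (x + y *+ 2)).
Proof.
move=> col ev; have [d3 altE altF] := col.
have evs y := @even_point_translate c d x y col ev.
(* [2 * (x.1 - x.2 - c)] is congruent to [c - (x.1 - x.2)] modulo 3. *)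
exists (x.1 - x.2 - c); split=> [y|y m|y m yc]; first exact: d3.
  by apply: (coarse_alternating evs) => //; exists 0; rewrite mul0rn addr0.
apply: (coarse_alternating evs) => //; last first.
  by apply: altF; move: yc; rewrite /in_class (mulr2n y) /=; lia.
(* [normal_vector m] and [unit_vector m] differ by twice a lattice vector. *)
by exists (unit_vector (m + 2)); rewrite /normal_vector -unit_vectorD mulr2n addrA.
Qed.

Theorem colouring_aperiodic c d z : alternating_colouring c d ->
  (forall x, d (x + z) = d x) -> z = 0.
Proof.
pose size z := (`|z.1| + `|z.2|)%N.
have [n] := ubnP (size z); elim: n c d z => // n IH c d z sz col per.
have [x ev] := even_point_exists col.
have [z' zE] := period_double col ev per.
have [c' col'] := coarse_colouring col ev.
have [z'0|z'0] := eqVneq z' 0; first by rewrite zE z'0 mul0rn.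
suff z'0' : z' = 0 by rewrite zE z'0' mul0rn.
apply: (IH c' _ _ _ col') => [|y]; last by rewrite mulrnDl addrA -zE per.
move: sz z'0; rewrite zE /size (mulr2n z'); case: (z') => a b; rewrite xpair_eqE /=; lia.
Qed.

End Colourings.

(** * Coordinates in the plane *)

Section Eisenstein.
Variable R : realType.
Implicit Types (x y a b t : R) (u v w z : R[i]) (m n k : nat) (p q : lattice).

Local Notation zeta := (zeta R).

(** Coordinates with respect to the basis [1], [zeta], adapted to hexagons. *)
Definition eis x y : R[i] := x%:C + y%:C * zeta.

Lemma sqrt3_sq : Num.sqrt 3%:R * Num.sqrt 3%:R = 3%:R :> R.
Proof. by rewrite -expr2 sqr_sqrtr. Qed.

Lemma eisE x y : eis x y = (x + y / 2) +i* (y * (Num.sqrt 3%:R / 2)).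
Proof. by rewrite /eis /zeta; simpc; congr (_ +i* _); field. Qed.

Lemma zeta_sq : zeta * zeta = zeta - 1.
Proof.
rewrite /zeta; apply/eqP; rewrite eq_complex /=; apply/andP.
by have s3 := sqrt3_sq; split; apply/eqP; move: (Num.sqrt _) s3 => s s3; nra.
Qed.

Lemma zeta3 : zeta ^+ 3 = -1.
Proof. by have z2 := zeta_sq; rewrite !exprS expr0 mulr1; ring: z2. Qed.

Lemma zeta6 : zeta ^+ 6 = 1.
Proof. by rewrite -[6%N]/(3 * 2)%N exprM zeta3 sqrrN expr1n. Qed.

Lemma zeta_mod m : zeta ^+ (m %% 6) = zeta ^+ m.
Proof. by rewrite expr_mod // zeta6. Qed.

Lemma zetaD3 m : zeta ^+ (m + 3) = - zeta ^+ m.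
Proof. by rewrite exprD zeta3 mulrN1. Qed.

(** In exponents of [zeta], [5 * m] plays the role of [- m]. *)
Lemma zeta_inv m : zeta ^+ m * zeta ^+ (5 * m) = 1.
Proof. by rewrite -exprD -mulSn exprM zeta6 expr1n. Qed.

Lemma zeta_split m n : zeta ^+ m = zeta ^+ n * zeta ^+ ((m + 5 * n) %% 6).
Proof. by rewrite zeta_mod exprD mulrCA zeta_inv mulr1. Qed.

Lemma zeta_neq0 : zeta != 0.
Proof. by apply/eqP => z0; have /eqP := zeta6; rewrite z0 expr0n /= eq_sym oner_eq0. Qed.

Lemma eis_surj w : exists x y, w = eis x y.
Proof.
have s0 : Num.sqrt 3%:R != 0 :> R by rewrite sqrtr_eq0 -ltNge ltr0n.
case: w => a b; exists (a - b / Num.sqrt 3%:R), (2 * b / Num.sqrt 3%:R).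
rewrite eisE; congr (_ +i* _); by field.
Qed.

Lemma eis_eq0 x y : eis x y = 0 -> x = 0 /\ y = 0.
Proof.
have s0 : Num.sqrt 3%:R != 0 :> R by rewrite sqrtr_eq0 -ltNge ltr0n.
rewrite eisE => /eqP; rewrite eq_complex /= => /andP[/eqP E1 /eqP].
move/eqP; rewrite mulf_eq0 mulf_eq0 invr_eq0 (negPf s0) /= (pnatr_eq0 _ 2) orbF.
by move=> /eqP y0; move: E1; rewrite y0; split => //; lra.
Qed.

Lemma zeta1_neq0 : 1 + zeta != 0.
Proof.
apply/eqP => E; have := @eis_eq0 1 1; rewrite /eis rmorph1 mul1r => /(_ E)[].
by lra.
Qed.

Lemma zetaB1_neq0 : zeta - 1 != 0.
Proof. by rewrite -zeta_sq mulf_neq0 ?zeta_neq0. Qed.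

Lemma eisD x y a b : eis x y + eis a b = eis (x + a) (y + b).
Proof. by rewrite /eis !rmorphD /=; ring. Qed.

Lemma eisN x y : - eis x y = eis (- x) (- y).
Proof. by rewrite /eis !rmorphN /=; ring. Qed.

Lemma eis_inj x y a b : eis x y = eis a b -> x = a /\ y = b.
Proof.
move=> E; have : eis (x - a) (y - b) = 0 by rewrite -eisD -eisN E subrr.
by case/eis_eq0 => /eqP; rewrite subr_eq0 => /eqP -> /eqP; rewrite subr_eq0 => /eqP.
Qed.

Lemma eisZ t x y : t%:C * eis x y = eis (t * x) (t * y).
Proof. by rewrite /eis !rmorphM /=; ring. Qed.

Lemma eisM_zeta x y : zeta * eis x y = eis (- y) (x + y).
Proof. by have z2 := zeta_sq; rewrite /eis rmorphN rmorphD /=; ring: z2. Qed.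

Lemma dotM u v w : dot (u * v) (u * w) = dot u u * dot v w.
Proof. by case: u v w => [? ?] [? ?] [? ?]; rewrite /dot /=; ring. Qed.

Lemma crossM u v w : cross (u * v) (u * w) = dot u u * cross v w.
Proof. by case: u v w => [? ?] [? ?] [? ?]; rewrite /dot /cross /=; ring. Qed.

Lemma dot_eis x y a b :
  dot (eis x y) (eis a b) = x * a + y * b + (x * b + y * a) / 2.
Proof.
have s3 := sqrt3_sq; rewrite !eisE /dot /=.
have -> : y * (Num.sqrt 3 / 2) * (b * (Num.sqrt 3 / 2)) =
    y * b * (Num.sqrt 3%:R * Num.sqrt 3%:R) / 4 by field.
by rewrite s3; field.
Qed.

Lemma dot_gt0 u : u != 0 -> 0 < dot u u.
Proof.
case: u => a b; rewrite eq_complex /= negb_and /dot /= => ab0.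
rewrite lt0r addr_ge0 -?expr2 ?sqr_ge0 // andbT paddr_eq0 ?sqr_ge0 // !sqrf_eq0.
by rewrite negb_and.
Qed.

Definition lattice_point p : R[i] := eis p.1%:~R p.2%:~R.

Lemma lattice_point0 : lattice_point 0 = 0.
Proof. by rewrite /lattice_point /eis !rmorph0 mul0r addr0. Qed.

Lemma lattice_pointD p q : lattice_point (p + q) = lattice_point p + lattice_point q.
Proof. by rewrite /lattice_point eisD -!rmorphD. Qed.

Lemma lattice_point_inj : injective lattice_point.
Proof.
by move=> [a b] [a' b'] /eis_inj[/= /intr_inj -> /intr_inj ->].
Qed.

Lemma lattice_point_unit m : lattice_point (unit_vector m) = zeta ^+ m.
Proof.
have z2 := zeta_sq; have z3 := zeta3.
rewrite -(zeta_mod m) /unit_vector /lattice_point /eis.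
have /= := ltn_pmod m (isT : 0 < 6)%N.
case: (m %% 6)%N => [|[|[|[|[|[|]]]]]] //= _; rewrite !rmorph_int.
- by rewrite expr0; ring.
- by rewrite expr1; ring.
- by rewrite expr2 z2; ring.
- by rewrite z3; ring.
- by rewrite exprS z3; ring.
- by rewrite -[5%N]/(2 + 3)%N exprD z3 expr2 z2; ring.
Qed.

End Eisenstein.

(** * Regular hexagons *)

Section Regions.
Variable R : realType.
Implicit Types (x y a b t : R) (u v w z : R[i]) (m n k : nat) (h : hexagon R).

Local Notation zeta := (zeta R).

(** In the coordinates [eis], the hexagon with vertices [zeta ^+ k]. *)
Definition in_unit_hexagon x y : Prop :=
  [/\ -1 <= x <= 1, -1 <= y <= 1 & -1 <= x + y <= 1].

Lemma in_unit_hexagon_rot n x y : in_unit_hexagon x y ->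
  exists x' y', in_unit_hexagon x' y' /\ zeta ^+ n * eis x y = eis x' y'.
Proof.
elim: n x y => [|n IH] x y xy; first by exists x, y; rewrite mul1r.
have : in_unit_hexagon (- y) (x + y) by case: xy => ? ? ?; split; lra.
by case/IH => x' [y' [xy' E]]; exists x', y'; rewrite exprSr -mulrA eisM_zeta E.
Qed.

Lemma sum_ord6 (V : zmodType) (F : 'I_6 -> V) :
  \sum_(k < 6) F k = F (inord 0) + F (inord 1) + F (inord 2) + F (inord 3) +
                     F (inord 4) + F (inord 5).
Proof.
rewrite !big_ord_recl big_ord0 addr0 !addrA.
by do ?congr (_ + _); congr F; apply: val_inj; rewrite /= inordK.
Qed.

Lemma vertex_combination (l : 'I_6 -> R) h : \sum_(k < 6) l k = 1 ->
  \sum_(k < 6) (l k)%:C * vertex h k = centre h + spoke h *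
    eis (l (inord 0) - l (inord 2) - l (inord 3) + l (inord 5))
        (l (inord 1) + l (inord 2) - l (inord 4) - l (inord 5)).
Proof.
have z2 := zeta_sq R; have z3 := zeta3 R.
rewrite !sum_ord6 /vertex !inordK //.
have -> : zeta ^+ 4 = - zeta by rewrite exprS z3; ring.
have -> : zeta ^+ 5 = 1 - zeta by rewrite -[5%N]/(2 + 3)%N exprD z3 expr2 z2; ring.
rewrite z3 expr2 z2 expr1 expr0.
move: (l _) (l _) (l _) (l _) (l _) (l _) => a0 a1 a2 a3 a4 a5 a1E.
have {a1E}-> : a0 = 1 - (a1 + a2 + a3 + a4 + a5) by rewrite -a1E; ring.
rewrite /eis !(rmorphD, rmorphN, rmorph1) /=; ring.
Qed.

Lemma regionP h z : region h z <->
  exists x y, in_unit_hexagon x y /\ z = centre h + spoke h * eis x y.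
Proof.
split.
  move=> [l [l0 l1 ->]]; rewrite vertex_combination //.
  do 2!eexists; split; last reflexivity.
  have := l0 (inord 0); have := l0 (inord 1); have := l0 (inord 2).
  have := l0 (inord 3); have := l0 (inord 4); have := l0 (inord 5).
  move: l1; rewrite sum_ord6 => *; split; lra.
have hull x y a0 a1 a2 a3 a4 a5 : 0 <= a0 -> 0 <= a1 -> 0 <= a2 -> 0 <= a3 ->
    0 <= a4 -> 0 <= a5 -> a0 + a1 + a2 + a3 + a4 + a5 = 1 ->
    x = a0 - a2 - a3 + a5 -> y = a1 + a2 - a4 - a5 ->
    region h (centre h + spoke h * eis x y).
  move=> p0 p1 p2 p3 p4 p5 suma -> ->.
  pose s := [:: a0; a1; a2; a3; a4; a5].
  pose l (k : 'I_6) := nth 0 s k.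
  have l1 : \sum_(k < 6) l k = 1 by rewrite sum_ord6 /l !inordK.
  exists l; split => //; last by rewrite vertex_combination // /l !inordK.
  move=> k; rewrite /l; case: k => k /= k6.
  have /allP -> // : all (fun a => 0 <= a) s by rewrite /= p0 p1 p2 p3 p4 p5.
  by rewrite mem_nth.
(* In each of the six sectors the point is a combination of two adjacent vertices,
   and the missing weight is shared equally between two opposite vertices. *)
move=> [x [y [[x1 y1 xy1] ->]]].
case: (lerP 0 x) => x0; case: (lerP 0 y) => y0; try case: (lerP 0 (x + y)) => xy0.
- by apply: (hull _ _ (x + (1 - x - y) / 2) y 0 ((1 - x - y) / 2) 0 0); lra.
- lra.
- by apply: (hull _ _ (x + y + (1 - x) / 2) 0 0 ((1 - x) / 2) 0 (- y)); lra.
- by apply: (hull _ _ ((1 + y) / 2) 0 0 ((1 + y) / 2) (- x - y) x); lra.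
- by apply: (hull _ _ ((1 - y) / 2) (x + y) (- x) ((1 - y) / 2) 0 0); lra.
- by apply: (hull _ _ ((1 + x) / 2) 0 y ((1 + x) / 2 - x - y) 0 0); lra.
- lra.
- by apply: (hull _ _ ((1 + x + y) / 2) 0 0 ((1 + x + y) / 2 - x) (- y) 0); lra.
Qed.

Lemma regionP_rot n h z : region h z <->
  exists x y, in_unit_hexagon x y /\ z = centre h + spoke h * zeta ^+ n * eis x y.
Proof.
rewrite regionP; split=> [] [x [y [xy ->]]]; last first.
  have [x' [y' [xy' E]]] := in_unit_hexagon_rot n xy.
  by exists x', y'; rewrite -mulrA E.
have [x' [y' [xy' E]]] := in_unit_hexagon_rot (5 * n) xy.
exists x', y'; split=> //.
by rewrite -E mulrA -(mulrA (spoke h)) zeta_inv mulr1.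
Qed.

Lemma centre_region h : region h (centre h).
Proof.
by apply/regionP; exists 0, 0; split; [split; lra|rewrite /eis rmorph0; ring].
Qed.

Lemma side_coords h k z : side h k z ->
  exists t, [/\ 0 <= t, t <= 1 & z = centre h + spoke h * zeta ^+ k * eis (1 - t) t].
Proof.
move=> [t [t0 t1 ->]]; exists t; split => //.
by rewrite /vertex /eis exprSr rmorphB /=; ring.
Qed.

Lemma centre_not_side h k : spoke h != 0 -> ~ side h k (centre h).
Proof.
move=> s0 /side_coords[t [_ _ /eqP]].
rewrite -[X in X == _]addr0 (inj_eq (addrI _)) eq_sym !mulf_eq0 (negPf s0) /=.
rewrite expf_eq0 (negPf (zeta_neq0 _)) andbF /= => /eqP/eis_eq0[]; lra.
Qed.

Lemma centre_not_vertex h k : spoke h != 0 -> vertex h k <> centre h.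
Proof.
move=> s0 /eqP; rewrite /vertex -[X in _ == X]addr0 (inj_eq (addrI _)) mulf_eq0 (negPf s0).
by rewrite expf_eq0 (negPf (zeta_neq0 _)) andbF.
Qed.

Lemma segment_ends u v u' v' : segment u v = segment u' v' ->
  (u = u' /\ v = v') \/ (u = v' /\ v = u').
Proof.
have left_end (p q : R[i]) : segment p q p by exists 0; rewrite lexx ler01 rmorph0 mul0r addr0.
have right_end (p q : R[i]) : segment p q q.
  by exists 1; rewrite lexx ler01 rmorph1 mul1r; split => //; ring.
move=> E.
have := left_end u v; have := right_end u v; rewrite E => -[b [b0 b1 vE]] [a [a0 a1 uE]].
have := left_end u' v'; have := right_end u' v'; rewrite -E => -[d [d0 d1 v'E]] [c [c0 c1 u'E]].
have E1 : v - u = (b - a)%:C * (v' - u') by rewrite rmorphB /= vE uE; ring.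
have E2 : v' - u' = (d - c)%:C * (v - u) by rewrite rmorphB /= v'E u'E; ring.
have [uv|uv] := eqVneq (v - u) 0.
  have uv' : v' - u' = 0 by rewrite E2 uv mulr0.
  left; rewrite uE vE uv' !mulr0 !addr0; split=> //.
  by apply/eqP; rewrite eq_sym -subr_eq0 uv'.
have inverse : (b - a) * (d - c) = 1.
  have : ((b - a) * (d - c))%:C * (v - u) = 1%:C * (v - u).
    by rewrite rmorphM -mulrA -E2 -E1 rmorph1 mul1r.
  by move/(mulIf uv); case.
(* The factors have absolute value at most [1], so both are [1] or both [-1]. *)
have [[a_0 b_1]|[a_1 b_0]] : (a = 0 /\ b = 1) \/ (a = 1 /\ b = 0).
- case: (lerP a b) => ab; [left|right]; split; nra.
- by left; rewrite uE vE a_0 b_1 rmorph0 rmorph1; split; ring.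
- by right; rewrite uE vE a_1 b_0 rmorph0 rmorph1; split; ring.
Qed.

Lemma segmentC u v : segment u v = segment v u.
Proof.
have sub (p q : R[i]) : (segment p q `<=` segment q p)%classic.
  move=> z [t [t0 t1 ->]]; exists (1 - t); split; [lra|lra|].
  by rewrite rmorphB rmorph1; ring.
by apply/seteqP; split; exact: sub.
Qed.

(** Two orders of the endpoints are possible: the same order gives the same hexagon,
    the opposite one its mirror image in the side. *)
Lemma common_side h h' k k' : side h k = side h' k' ->
  centre h = centre h' \/
  centre h' = centre h + spoke h * (zeta ^+ k + zeta ^+ k.+1) /\
  spoke h' * zeta ^+ k' = - (spoke h * zeta ^+ k).
Proof.
move=> sE.
have same_spoke u v c c' : c + u * zeta ^+ k.+1 - (c + u * zeta ^+ k) =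
    c' + v * zeta ^+ k'.+1 - (c' + v * zeta ^+ k') -> u * zeta ^+ k = v * zeta ^+ k'.
  move=> E; apply: (mulIf (zetaB1_neq0 R)).
  have -> : u * zeta ^+ k * (zeta - 1) = c + u * zeta ^+ k.+1 - (c + u * zeta ^+ k).
    by rewrite exprSr; ring.
  by rewrite E exprSr; ring.
have [] := segment_ends sE; rewrite /vertex => -[E E'].
  left; have spE : spoke h * zeta ^+ k = spoke h' * zeta ^+ k'.
    by apply: (@same_spoke _ _ (centre h) (centre h')); rewrite E E'.
  by move: E; rewrite spE => /addIr.
right; have spE : - spoke h * zeta ^+ k = spoke h' * zeta ^+ k'.
  by apply: (@same_spoke _ _ (- centre h) (centre h')); rewrite -E -E'; ring.
split; last by rewrite -spE mulNr.
have -> : centre h' = centre h' + spoke h' * zeta ^+ k' - spoke h' * zeta ^+ k'.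
  by rewrite addrK.
by rewrite -E' -spE exprSr; ring.
Qed.

(** The midpoint of [side h k] is [centre h + spoke h * zeta ^+ k * eis 2^-1 2^-1]. *)
Lemma midpoint_not_vertex h k i : spoke h != 0 ->
  centre h + spoke h * zeta ^+ k * eis 2^-1 2^-1 <> vertex h i.
Proof.
move=> s0; rewrite /vertex (zeta_split _ i k) mulrA => /addrI/mulfI.
rewrite mulf_neq0 ?expf_neq0 ?zeta_neq0 // => /(_ isT).
rewrite -lattice_point_unit /lattice_point => /eis_inj[half _].
have : (2 * (unit_vector ((i + 5 * k) %% 6)).1)%:~R = 1%:~R :> R.
  by rewrite intrM -half /=; field.
by move/intr_inj; lia.
Qed.

Lemma midpoint_side h k i : spoke h != 0 ->
  side h i (centre h + spoke h * zeta ^+ k * eis 2^-1 2^-1) ->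
  zeta ^+ i = zeta ^+ k.
Proof.
move=> s0 /side_coords[x [x0 x1]].
rewrite (zeta_split _ i k) mulrA => /addrI; rewrite -[RHS]mulrA => /mulfI.
rewrite mulf_neq0 ?expf_neq0 ?zeta_neq0 // => /(_ isT).
case: (_ %% 6)%N (ltn_pmod (i + 5 * k) (isT : 0 < 6)%N) => [|[|[|[|[|[|]]]]]] //= _.
  by rewrite expr0 mulr1.
all: rewrite !exprS expr0 ?mulr1 -?mulrA !eisM_zeta => /eis_inj[X Y]; exfalso; lra.
Qed.

End Regions.

(** * Edge-to-edge tilings by regular hexagons *)

Lemma infinite_pigeonhole (F : finType) (f : nat -> F) :
  exists c, forall N, exists2 n, (N <= n)%N & f n = c.
Proof.
apply: contrapT => /forallNP none.
have /choice[N Nmax] : forall c, exists N, forall n, (N <= n)%N -> f n <> c.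
  move=> c; apply: contrapT => /forallNP often; apply: (none c) => N.
  by apply: contrapT => no; apply: (often N) => n Nn fn; apply: no; exists n.
pose n := \max_c N c.
by apply: (Nmax (f n) n) => //; apply: leq_bigmax.
Qed.

Section Tilings.
Variable R : realType.
Implicit Types (x y a b : R) (u v w z : R[i]) (m n k : nat) (h : hexagon R).

Local Notation zeta := (zeta R).

Lemma le_of_frequently a b c :
  (forall N, exists2 n, (N <= n)%N & a + b / n.+1%:R <= c) -> a <= c.
Proof.
move=> freq; rewrite leNgt; apply/negP => ca.
have [n] := freq (Num.truncn (`|b| / (a - c))).
set N := Num.truncn _ => Nn; apply/negP; rewrite -ltNge.
have d0 : 0 < a - c by lra.
have n0 : 0 < n.+1%:R :> R by rewrite ltr0n.
have : `|b| / (a - c) < n.+1%:R.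
  apply: lt_le_trans (truncnS_gt _) _; by rewrite ler_nat.
rewrite ltr_pdivrMr // => lt_b.
have : - (a - c) < b / n.+1%:R.
  rewrite ltr_pdivlMr // mulNr ltrNl; apply: le_lt_trans (_ : `|b| < _).
    by rewrite -normrN ler_norm.
  by rewrite mulrC.
by move: (b / _) => q ?; lra.
Qed.

(** The closedness of the hexagon, along a sequence on a ray. *)
Lemma in_unit_hexagon_limit x y a b :
  (forall N, exists2 n, (N <= n)%N &
     in_unit_hexagon (x + a / n.+1%:R) (y + b / n.+1%:R)) ->
  in_unit_hexagon x y.
Proof.
move=> freq; have le1 (c d : R) :
    (forall n, in_unit_hexagon (x + a / n.+1%:R) (y + b / n.+1%:R) ->
      c + d / n.+1%:R <= 1) -> c <= 1.
  move=> cd; apply: (@le_of_frequently c d) => N.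
  by have [n Nn xy] := freq N; exists n => //; apply: cd.
split; apply/andP; split; rewrite 1?lerNl.
- by apply: (le1 _ (- a)) => n [+ _ _]; rewrite mulNr; move: (a / _) => A ?; lra.
- by apply: (le1 _ a) => n [+ _ _]; move: (a / _) => A ?; lra.
- by apply: (le1 _ (- b)) => n [_ + _]; rewrite mulNr; move: (b / _) => A ?; lra.
- by apply: (le1 _ b) => n [_ + _]; move: (b / _) => A ?; lra.
- apply: (le1 _ (- (a + b))) => n [_ _]; rewrite mulNr mulrDl.
  by move: (a / _) (b / _) => A B ?; lra.
- apply: (le1 _ (a + b)) => n [_ _]; rewrite mulrDl.
  by move: (a / _) (b / _) => A B ?; lra.
Qed.

Lemma same_cell (l a b : R) : 0 < l -> 0 <= a -> 0 <= b ->
  Num.truncn (a / l) = Num.truncn (b / l) -> (a - b) ^+ 2 <= l ^+ 2.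
Proof.
move=> l0 a0 b0 E.
have := truncn_itv (divr_ge0 a0 (ltW l0)); have := truncn_itv (divr_ge0 b0 (ltW l0)).
rewrite E -natr1; move: (_%:R) => r.
rewrite !ler_pdivlMr // !ltr_pdivrMr // => /andP[b1 b2] /andP[a1 a2].
by rewrite !expr2; nra.
Qed.

Variables (I : Type) (hex : I -> hexagon R) (T : set I).
Hypothesis tiling : edge_to_edge_tiling hex T.

Lemma spoke_neq0 t : T t -> spoke (hex t) != 0.
Proof.
case: tiling => -[s s0 sE] _ _ /sE ls; apply/eqP => E.
by move: s0; rewrite -ls E /len /dot /= !mul0r addr0 sqrtr0 ltxx.
Qed.

Lemma spoke_dot t t' : T t -> T t' ->
  dot (spoke (hex t)) (spoke (hex t)) = dot (spoke (hex t')) (spoke (hex t')).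
Proof.
have dge v : 0 <= dot v v by rewrite /dot -!expr2 addr_ge0 ?sqr_ge0.
case: tiling => -[s s0 sE] _ _ /sE + /sE.
by rewrite /len => E E'; rewrite -(sqr_sqrtr (dge _)) E -E' sqr_sqrtr.
Qed.

(** A centre lies in the interior of its tile, hence in no common side or vertex. *)
Lemma tile_of_centre t t' : T t -> T t' ->
  region (hex t) (centre (hex t')) -> t = t'.
Proof.
move=> Tt Tt' ct'; have s0 := spoke_neq0 Tt'; apply: contrapT => ne.
case: tiling => _ _ /(_ t t' Tt Tt' ne) [A0|[k [k' [vE A]]]|[k [k' [sE A]]]].
- suff : (set0 : set R[i]) (centre (hex t')) by [].
  by rewrite -A0; split=> //; exact: centre_region.
- suff : [set vertex (hex t) k]%classic (centre (hex t')).
    by rewrite vE => /esym; exact: centre_not_vertex.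
  by rewrite -A; split=> //; exact: centre_region.
- suff : side (hex t) k (centre (hex t')) by rewrite sE; exact: centre_not_side.
  by rewrite -A; split=> //; exact: centre_region.
Qed.

Lemma close_centres_eq t t' : T t -> T t' ->
  dot (centre (hex t') - centre (hex t)) (centre (hex t') - centre (hex t)) <=
    dot (spoke (hex t)) (spoke (hex t)) / 2 -> t = t'.
Proof.
move=> Tt Tt'; have s0 := spoke_neq0 Tt.
have [x [y E]] := eis_surj ((centre (hex t') - centre (hex t)) / spoke (hex t)).
have {}E : centre (hex t') - centre (hex t) = spoke (hex t) * eis x y.
  by rewrite -E mulrC mulfVK.
rewrite E dotM ler_pM2l ?dot_gt0 // dot_eis => le2.
apply: tile_of_centre => //; apply/regionP; exists x, y; split.
  have le1 a : a ^+ 2 <= 1 -> -1 <= a <= 1.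
    by rewrite expr2 => a1; apply/andP; split; nra.
  have := sqr_ge0 (y + x / 2); have := sqr_ge0 (x + y / 2).
  have := sqr_ge0 (x - y); rewrite !expr2 => h1 h2 h3.
  by split; apply: le1; rewrite expr2; nra.
by rewrite -E; ring.
Qed.

(** Since centres of different tiles are not close, cells of a fine enough square
    grid contain at most one centre each, and only finitely many cells meet a
    bounded region. *)
Lemma frequent_tile (c : R[i]) (B : R) (p : nat -> R[i]) (t : nat -> I) :
  (forall n, T (t n)) -> (forall n, region (hex (t n)) (p n)) ->
  (forall n, dot (p n - c) (p n - c) <= B) ->
  exists n0, forall N, exists2 n, (N <= n)%N & t n = t n0.
Proof.
move=> Tt pt pB.
pose D := dot (spoke (hex (t 0%N))) (spoke (hex (t 0%N))).
have D0 : 0 < D by apply: dot_gt0; exact: spoke_neq0.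
pose r n := centre (hex (t n)) - c.
(* [2 * (B + 3 * D)] bounds the squared distance from [c] to the centres; as
   [r ^+ 2 <= M - 1] implies [`|r| <= M], the coordinates are bounded by [M]. *)
pose M := 2 * B + 6 * D + 1.
have rM n : dot (r n) (r n) <= M - 1.
  have [x [y [[xb yb _] pE]]] := (regionP _ _).1 (pt n).
  have spD : dot (spoke (hex (t n)) * eis x y) (spoke (hex (t n)) * eis x y) <= 3 * D.
    rewrite dotM -(spoke_dot (Tt 0%N) (Tt n)) mulrC ler_pM2r // dot_eis; nra.
  have := pB n; move: spD.
  have -> : r n = (p n - c) - spoke (hex (t n)) * eis x y by rewrite /r pE; ring.
  case: (p n - c) => a b; case: (_ * _) => a' b'; rewrite /dot /M /=.
  by have := sqr_ge0 (a + a'); have := sqr_ge0 (b + b'); rewrite !expr2; lra.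
have M1 : 1 <= M by have := rM 0%N; rewrite /dot; nra.
(* The mesh of the grid: the diagonal of a cell has squared length [D / 2]. *)
pose l := Num.sqrt D / 2.
have l2 : l ^+ 2 + l ^+ 2 = D / 2.
  by rewrite /l expr_div_n sqr_sqrtr ?ltW //; field.
have l0 : 0 < l by rewrite divr_gt0 // sqrtr_gt0.
pose K := Num.truncn (2 * M / l).
pose cell a : 'I_K.+1 := inord (Num.truncn ((a + M) / l)).
have cellP a b : a ^+ 2 <= M - 1 -> b ^+ 2 <= M - 1 -> cell a = cell b ->
    (a - b) ^+ 2 <= l ^+ 2.
  have bound a' : a' ^+ 2 <= M - 1 -> 0 <= a' + M <= 2 * M.
    by rewrite expr2 => ?; apply/andP; split; nra.
  move=> /bound/andP[a1 a2] /bound/andP[b1 b2] /(congr1 val) /=.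
  have ltK a' : 0 <= a' + M -> a' + M <= 2 * M -> (Num.truncn ((a' + M) / l) < K.+1)%N.
    by move=> ? ?; rewrite ltnS le_truncn // ler_pM2r // invr_gt0.
  rewrite !inordK ?ltK // => /same_cell - /(_ l0 a1 b1).
  by have -> : a + M - (b + M) = a - b by ring.
have [v often] := infinite_pigeonhole
  (fun n => (cell (complex.Re (r n)), cell (complex.Im (r n)))).
have [n0 _ n0v] := often 0%N.
exists n0 => N; have [n Nn nv] := often N; exists n => //.
apply: close_centres_eq => //; rewrite -(spoke_dot (Tt 0%N) (Tt n)) -/D -l2.
have := rM n; have := rM n0; move: nv; rewrite -n0v => -[].
have -> : centre (hex (t n0)) - centre (hex (t n)) = r n0 - r n by rewrite /r; ring.
case: (r n) => a b; case: (r n0) => a' b'; rewrite /dot /= -!expr2 => ea eb h h'.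
have sa := sqr_ge0 a; have sb := sqr_ge0 b; have sa' := sqr_ge0 a'; have sb' := sqr_ge0 b'.
rewrite lerD // cellP // ?ea ?eb //; lra.
Qed.

(** Points outside the side [k] and converging to its midpoint lie infinitely often
    in one and the same tile, which therefore contains the midpoint.  It meets the
    tile [t0] in an inner point of the side [k], so in that whole side. *)
Lemma tile_across_side t0 k : T t0 -> exists t1, [/\ T t1,
  centre (hex t1) = centre (hex t0) + spoke (hex t0) * (zeta ^+ k + zeta ^+ k.+1) &
  exists j, spoke (hex t1) = spoke (hex t0) * zeta ^+ j].
Proof.
move=> Tt0; set h := hex t0; have s0 := spoke_neq0 Tt0; rewrite -/h in s0.
pose q e : R[i] := centre h + spoke h * zeta ^+ k * eis (2^-1 + e) (2^-1 + e).
have outside e : 0 < e -> ~ region h (q e).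
  move=> e0 /(regionP_rot k)[x [y [[_ _ xy1] /addrI/mulfI]]].
  rewrite mulf_neq0 ?expf_neq0 ?zeta_neq0 // => /(_ isT)/eis_inj[xE yE].
  lra.
pose e n : R := n.+1%:R^-1.
have e0 n : 0 < e n by rewrite invr_gt0 ltr0n.
have e1 n : e n <= 1 by rewrite invf_le1 ?ltr0n // ler1n.
have /choice[t Pt] n : exists t, T t /\ region (hex t) (q (e n)).
  by case: tiling => _ /(_ (q (e n)))[t Tt rt] _; exists t.
have Tt n : T (t n) by case: (Pt n).
have rt n : region (hex (t n)) (q (e n)) by case: (Pt n).
pose r := spoke h * zeta ^+ k.
have r0 : r != 0 by rewrite mulf_neq0 ?expf_neq0 ?zeta_neq0.
have qB n : dot (q (e n) - centre h) (q (e n) - centre h) <= dot r r * 7.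
  rewrite /q -/r addrC addKr dotM ler_pM2l ?dot_gt0 // dot_eis.
  have := e0 n; have := e1 n; move: (e n) => a a1 a0; nra.
have [n0 often] := frequent_tile Tt rt qB.
have Tt1 := Tt n0; set t1 := t n0 in Tt1 often; set h1 := hex t1.
have s1 : spoke h1 != 0 := spoke_neq0 Tt1.
pose m := q 0.
have m1 : region h1 m.
  have [x [y /(canRL (divfK s1)) mE]] := eis_surj ((m - centre h1) / spoke h1).
  have [a [b /(canRL (divfK s1)) uE]] := eis_surj (r * eis 1 1 / spoke h1).
  have qE n : q (e n) = centre h1 + spoke h1 * eis (x + a / n.+1%:R) (y + b / n.+1%:R).
    have -> : q (e n) = centre h1 + (m - centre h1) + (e n)%:C * (r * eis 1 1).
      rewrite /m /q -/r mulrCA eisZ addr0 mulr1 -eisD; ring.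
    rewrite mE uE mulrA eisZ -!(mulrC (spoke h1)) -addrA -mulrDr eisD.
    by rewrite /e ![_^-1 * _]mulrC.
  have freq N : exists2 n, (N <= n)%N & in_unit_hexagon (x + a / n.+1%:R) (y + b / n.+1%:R).
    have [n Nn tn] := often N; exists n => //.
    have := rt n; rewrite tn -/h1 => /regionP[x' [y' [xy' ]]].
    by rewrite qE => /addrI/(mulfI s1)/eis_inj[-> ->].
  apply/regionP; exists x, y; split; last by rewrite mulrC -mE; ring.
  exact: in_unit_hexagon_limit freq.
have t01 : t0 <> t1.
  by move=> E; apply: (outside _ (e0 n0)); rewrite /h E; exact: rt.
have m0 : region h m.
  have half : in_unit_hexagon (2^-1 : R) 2^-1 by split; lra.
  apply: (regionP_rot k h m).2; exists 2^-1, 2^-1; split; first exact: half.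
  by rewrite /m /q addr0.
have : (region h `&` region h1)%classic m by [].
case: tiling => _ _ /(_ t0 t1 Tt0 Tt1 t01); rewrite -/h -/h1.
have mE : m = centre h + spoke h * zeta ^+ k * eis 2^-1 2^-1 by rewrite /m /q addr0.
case=> [->|[i [i' [_ ->]]]|[i [i' [sE ->]]]] //=; rewrite mE.
  by move/midpoint_not_vertex; case.
move/(midpoint_side s0) => ik; have [cE|[cE spE]] := common_side sE.
  case: t01; apply: (tile_of_centre Tt0 Tt1).
  by rewrite -/h1 -cE; exact: centre_region.
exists t1; split=> //; first by rewrite -/h1 cE !exprSr ik.
exists (k + 3 + 5 * i')%N.
by rewrite -/h1 -[LHS]mulr1 -(zeta_inv R i') mulrA spE ik exprD zetaD3; ring.
Qed.
End Tilings.

(** * The lattice of tiles *)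

Section LatticeTiling.
Variable R : realType.
Implicit Types (x y a b : R) (u v w z : R[i]) (m n k : nat) (h : hexagon R) (p q : lattice).

Local Notation zeta := (zeta R).

Variables (I : Type) (hex : I -> hexagon R) (T : set I).
Hypothesis tiling : edge_to_edge_tiling hex T.
Variable t0 : I.
Hypothesis Tt0 : T t0.

Definition tile_site p : R[i] :=
  centre (hex t0) + spoke (hex t0) * (1 + zeta) * lattice_point R p.

Lemma tile_at_site p : exists t, [/\ T t, centre (hex t) = tile_site p &
  exists j, spoke (hex t) = spoke (hex t0) * zeta ^+ j].
Proof.
elim/lattice_ind: p => [|p m [t [Tt ct [j st]]]].
  exists t0; split=> //; last by exists 0%N; rewrite mulr1.
  by rewrite /tile_site /lattice_point /eis /=; ring.
have [t1 [Tt1 ct1 [j1 st1]]] := tile_across_side tiling (m + 5 * j) Tt.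
exists t1; split=> //; last by exists (j + j1)%N; rewrite st1 st -mulrA exprD.
rewrite ct1 ct st /tile_site lattice_pointD lattice_point_unit exprSr exprD.
have -> c d : c * zeta ^+ j * (zeta ^+ m * d + zeta ^+ m * d * zeta) =
    c * (1 + zeta) * zeta ^+ m * (zeta ^+ j * d) by ring.
by rewrite zeta_inv mulr1; ring.
Qed.

(** Every point is in a hexagon of the lattice tiling: round its lattice coordinates
    to one of the four surrounding lattice points. *)
Lemma near_site z : exists p x y,
  in_unit_hexagon x y /\ z = tile_site p + spoke (hex t0) * eis x y.
Proof.
have s0 := spoke_neq0 tiling Tt0.
have s1 : spoke (hex t0) * (1 + zeta) != 0 by rewrite mulf_neq0 ?zeta1_neq0.
have [x [y /(canRL (divfK s1)) zE]] :=
  eis_surj ((z - centre (hex t0)) / (spoke (hex t0) * (1 + zeta))).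
have split_xy (p : lattice) (a b : R) : x = p.1%:~R + a -> y = p.2%:~R + b ->
    in_unit_hexagon (a - b) (a + b + b) -> exists p x y,
    in_unit_hexagon x y /\ z = tile_site p + spoke (hex t0) * eis x y.
  move=> xE yE ab; exists p, (a - b), (a + b + b); split=> //.
  have -> : eis (a - b) (a + b + b) = (1 + zeta) * eis a b.
    by rewrite mulrDl mul1r eisM_zeta eisD; congr eis; ring.
  have -> : z = centre (hex t0) + (z - centre (hex t0)) by ring.
  have {}zE : z - centre (hex t0) = (lattice_point R p + eis a b) * (spoke (hex t0) * (1 + zeta)).
    by rewrite zE xE yE eisD.
  by rewrite zE /tile_site; ring.
have := floor_itv x; have := floor_itv y; rewrite !intrD.
move: (Num.floor x) (Num.floor y) => i j /andP[b0 b1] /andP[a0 a1].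
pose a := x - i%:~R; pose b := y - j%:~R.
have [aE bE] : x = i%:~R + a /\ y = j%:~R + b by rewrite /a /b; split; ring.
have {a0 a1} [a0 a1] : 0 <= a /\ a <= 1 by rewrite /a; split; lra.
have {b0 b1} [b0 b1] : 0 <= b /\ b <= 1 by rewrite /b; split; lra.
clearbody a b.
have [g|g] := lerP (a + b + b) 1; have [g'|g'] := lerP (a + a + b) 1.
- by apply: (split_xy (i, j) a b) => //; split; lra.
- by apply: (split_xy (i + 1, j) (a - 1) b) => //=; [rewrite intrD; lra|split; lra].
- by apply: (split_xy (i, j + 1) a (b - 1)) => //=; [rewrite intrD; lra|split; lra].
have [g2|g2] := lerP 2 (a + b + b); have [g2'|g2'] := lerP 2 (a + a + b).
- apply: (split_xy (i + 1, j + 1) (a - 1) (b - 1)) => //=; rewrite ?intrD.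
  + by lra.
  + by lra.
  + by split; lra.
- by apply: (split_xy (i, j + 1) a (b - 1)) => //=; [rewrite intrD; lra|split; lra].
- by apply: (split_xy (i + 1, j) (a - 1) b) => //=; [rewrite intrD; lra|split; lra].
- have [ab|ab] := lerP a b.
  + by apply: (split_xy (i, j + 1) a (b - 1)) => //=; [rewrite intrD; lra|split; lra].
  + by apply: (split_xy (i + 1, j) (a - 1) b) => //=; [rewrite intrD; lra|split; lra].
Qed.

Lemma tile_has_site t : T t -> exists p, centre (hex t) = tile_site p.
Proof.
move=> Tt; have [p [x [y [xy ctE]]]] := near_site (centre (hex t)).
have [t1 [Tt1 ct1 [j st1]]] := tile_at_site p.
exists p; rewrite -ct1; congr (centre (hex _)); apply/esym.
apply: (tile_of_centre tiling Tt1 Tt); rewrite ctE -ct1.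
have [x' [y' [xy' E]]] := in_unit_hexagon_rot (5 * j) xy.
apply/regionP; exists x', y'; split=> //; rewrite st1 -E mulrA.
by rewrite -(mulrA (spoke (hex t0))) zeta_inv mulr1.
Qed.
End LatticeTiling.

(** * Arrows *)

(** With [spoke h = rho * zeta ^+ j], the side of [h] whose midpoint is seen from the
    centre in the direction [rho * (1 + zeta) * zeta ^+ m]. *)
Definition side_towards (j m : nat) : 'I_6 := inord ((m + 5 * j) %% 6)%N.

(** The arrow on that side runs counterclockwise. *)
Definition ccw (j m : nat) : bool := ((m + 5 * j) %% 6)%N \in [:: 0; 1; 4]%N.

Lemma ccwD j m k :
  ccw j (m + k) = ((((m + 5 * j) %% 6 + k) %% 6)%N \in [:: 0; 1; 4]%N).
Proof. by rewrite /ccw modnDml addnAC. Qed.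

(** The sides crossed by the stripe carry parallel arrows. *)
Lemma ccw_stripe j m : m = j %[mod 3] -> ccw j (m + 3) = ~~ ccw j m.
Proof.
rewrite ccwD /ccw => mj; have {mj} : (((m + 5 * j) %% 6) %% 3 = 0)%N.
  by rewrite modn_dvdm //; lia.
by case: (_ %% 6)%N (ltn_pmod (m + 5 * j) (isT : 0 < 6)%N) => [|[|[|[|[|[|]]]]]].
Qed.

(** The other pairs of opposite sides carry antiparallel arrows, whose sense depends
    on the stripe only as a line. *)
Lemma ccw_corner j j' m : m != j %[mod 3] -> j = j' %[mod 3] ->
  ccw j (m + 3) = ccw j' m.
Proof.
rewrite ccwD /ccw => mj jj'.
have : (((m + 5 * j) %% 6) %% 3 = ((m + 5 * j') %% 6) %% 3)%N.
  by rewrite !modn_dvdm //; lia.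
have : (((m + 5 * j) %% 6) %% 3 != 0)%N by rewrite modn_dvdm //; lia.
case: (_ %% 6)%N (ltn_pmod (m + 5 * j) (isT : 0 < 6)%N) => [|[|[|[|[|[|]]]]]] //;
by case: (_ %% 6)%N (ltn_pmod (m + 5 * j') (isT : 0 < 6)%N) => [|[|[|[|[|[|]]]]]].
Qed.

(** Up to rotation the alternate arrows are [ccw, cw, ccw] or [ccw, cw, cw], which
    have no symmetry, so they locate the stripe. *)
Lemma ccw_determined j j' m :
  (forall i, (i < 3)%N -> ccw j (m + 2 * i) = ccw j' (m + 2 * i)) -> j = j' %[mod 3].
Proof.
move=> E; have {E} := (E 0%N isT, E 1%N isT, E 2%N isT); rewrite !ccwD => E.
have jj : (((m + 5 * j) %% 6) %% 3 = ((m + 5 * j') %% 6) %% 3)%N.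
  move: E.
  case: (_ %% 6)%N (ltn_pmod (m + 5 * j) (isT : 0 < 6)%N) => [|[|[|[|[|[|]]]]]] //;
  by case: (_ %% 6)%N (ltn_pmod (m + 5 * j') (isT : 0 < 6)%N) => [|[|[|[|[|[|]]]]]] // _ _ [[]].
by move: jj; rewrite !modn_dvdm //; lia.
Qed.

(** The six rotations of the pattern of arrows realize the six mixed triples. *)
Lemma ccw_complete m (s : nat -> bool) :
  ~ (forall i, (i < 3)%N -> s i) -> ~ (forall i, (i < 3)%N -> ~~ s i) ->
  exists j, forall i, (i < 3)%N -> ccw j (m + 2 * i) = s i.
Proof.
have values k : exists j, forall i, (i < 3)%N ->
    ccw j (m + 2 * i) = (((k + 2 * i) %% 6)%N \in [:: 0; 1; 4]%N).
  exists (m + 5 * k)%N => i _; rewrite ccwD modnDml.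
  by rewrite (_ : m + 5 * (m + 5 * k) + 2 * i = (m + 4 * k) * 6 + (k + 2 * i))%N ?modnMDl //; lia.
case s0: (s 0%N); case s1: (s 1%N); case s2: (s 2%N) => some_cw some_ccw.
- by case: some_cw => -[|[|[|]]].
- by have [j E] := values 4%N; exists j => -[|[|[|]]] // i3; rewrite E.
- by have [j E] := values 0%N; exists j => -[|[|[|]]] // i3; rewrite E.
- by have [j E] := values 1%N; exists j => -[|[|[|]]] // i3; rewrite E.
- by have [j E] := values 2%N; exists j => -[|[|[|]]] // i3; rewrite E.
- by have [j E] := values 5%N; exists j => -[|[|[|]]] // i3; rewrite E.
- by have [j E] := values 3%N; exists j => -[|[|[|]]] // i3; rewrite E.
- by case: some_ccw => -[|[|[|]]] // _; rewrite ?s0 ?s1 ?s2.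
Qed.

Section Arrows.
Variable R : realType.
Implicit Types (u v w z rho : R[i]) (j m n k : nat) (h : hexagon R) (p q x : lattice).

Local Notation zeta := (zeta R).

Lemma vertex_towards h rho j m i : spoke h = rho * zeta ^+ j ->
  vertex h (side_towards j m + i) = centre h + rho * zeta ^+ (m + i).
Proof.
rewrite /vertex => ->; rewrite -mulrA -exprD inordK ?ltn_mod //; congr (_ + _ * _).
by rewrite -zeta_mod -[RHS]zeta_mod; congr (_ ^+ _); lia.
Qed.

Lemma arrow_towards h rho j m : spoke h = rho * zeta ^+ j ->
  arrow h (side_towards j m) =
    if ccw j m then (centre h + rho * zeta ^+ m, centre h + rho * zeta ^+ (m + 1))
    else (centre h + rho * zeta ^+ (m + 1), centre h + rho * zeta ^+ m).
Proof.
move=> sE; have v i := vertex_towards m i sE.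
have := v 0%N; have := v 1%N; rewrite !addn0 addn1 => E1 E0.
by rewrite /arrow E0 E1 /side_towards inordK ?ltn_mod.
Qed.

Lemma side_towardsE h rho j m : spoke h = rho * zeta ^+ j ->
  side h (side_towards j m) =
    segment (centre h + rho * zeta ^+ m) (centre h + rho * zeta ^+ (m + 1)).
Proof.
move=> sE; have v i := vertex_towards m i sE.
by have := v 0%N; have := v 1%N; rewrite /side !addn0 addn1 => -> ->.
Qed.

Lemma adjacent_arrows (S : set (hexagon R)) h h' rho j j' m :
  well_matched S -> S h -> S h' -> rho != 0 ->
  spoke h = rho * zeta ^+ j -> spoke h' = rho * zeta ^+ j' ->
  centre h' = centre h + rho * (zeta ^+ m + zeta ^+ (m + 1)) ->
  ccw j' (m + 3) = ~~ ccw j m.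
Proof.
move=> wm Sh Sh' rho0 sE sE' cE.
have ends0 : centre h' + rho * zeta ^+ (m + 3) = centre h + rho * zeta ^+ (m + 1).
  by rewrite zetaD3 cE; ring.
have ends1 : centre h' + rho * zeta ^+ (m + 3 + 1) = centre h + rho * zeta ^+ m.
  by rewrite addnAC zetaD3 cE; ring.
have := wm h h' Sh Sh' (side_towards j m) (side_towards j' (m + 3)).
rewrite (side_towardsE _ sE) (side_towardsE _ sE') (arrow_towards _ sE) (arrow_towards _ sE').
rewrite ends0 ends1 => /(_ (segmentC _ _)).
have ne : centre h + rho * zeta ^+ m != centre h + rho * zeta ^+ (m + 1).
  rewrite (inj_eq (addrI _)) (inj_eq (mulfI rho0)) exprD expr1 -[X in X == _]mulr1.
  rewrite (inj_eq (mulfI _)) ?expf_neq0 ?zeta_neq0 //.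
  by rewrite eq_sym -subr_eq0 zetaB1_neq0.
by case: (ccw j m); case: (ccw j' (m + 3)) => //= -[E _]; rewrite E eqxx in ne.
Qed.

(** Between two consecutive hexagons with stripe off the line, the arrow on the
    common sides is handed on; the second hexagon sees it from the other side, so
    its sense there is opposite to the one seen by the first, and equal stripes
    would give equal senses. *)
Theorem arrows_alternate (S : set (hexagon R)) (H : lattice -> hexagon R)
    (J : lattice -> nat) (o rho : R[i]) :
  well_matched S -> rho != 0 -> (forall x, S (H x)) ->
  (forall x, centre (H x) = o + rho * (1 + zeta) * lattice_point R x) ->
  (forall x, spoke (H x) = rho * zeta ^+ J x) ->
  forall x m, alternating (fun y => J y %% 3)%N x (unit_vector m) (m %% 3).
Proof.
move=> wm rho0 SH cH sH x m w n wm0 n0 Jx Jbetween.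
have adj i : ccw (J (x + unit_vector m *+ i.+1)) (m + 3) = ~~ ccw (J (x + unit_vector m *+ i)) m.
  apply: (adjacent_arrows wm (SH _) (SH _) rho0 (sH _) (sH _)).
  by rewrite !cH mulrSr addrA !lattice_pointD lattice_point_unit exprD expr1; ring.
apply/eqP => Jxn.
have const i : (i < n)%N -> ccw (J (x + unit_vector m *+ i)) m = ccw (J x) m.
  elim: i => [|i IH] i_n; first by rewrite mulr0n addr0.
  rewrite -IH; last by lia.
  have := adj i; rewrite ccw_stripe; first by move/negb_inj.
  by rewrite Jbetween.
have := adj n.-1; rewrite prednK // const; last by lia.
rewrite (@ccw_corner _ (J x)); first by case: (ccw _ _).
  by rewrite Jxn eq_sym.
by rewrite Jxn Jx.
Qed.
End Arrows.

(** * Double hexagon tilings *)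

(** The lattice of the outer hexagons inside that of the small ones: multiplication
    by [1 + zeta], of absolute value [sqrt 3]. *)
Definition sublattice (p : lattice) : lattice := (p.1 - p.2, p.1 + p.2 *+ 2).

Lemma sublatticeD p q : sublattice (p + q) = sublattice p + sublattice q.
Proof. by apply/eqP; rewrite xpair_eqE /= !mulr2n; lia. Qed.

Lemma sublatticeMn p n : sublattice (p *+ n) = sublattice p *+ n.
Proof. by elim: n => [|n IH]; rewrite ?mulr0n // !mulrSr sublatticeD IH. Qed.

Lemma sublattice_inj : injective sublattice.
Proof. by move=> [a b] [a' b'] [] E1 E2; congr (_, _); move: E1 E2; rewrite !mulr2n; lia. Qed.

Lemma sublattice_unit m :
  sublattice (unit_vector m) = unit_vector m + unit_vector (m + 1).
Proof. by rewrite /sublattice; hexagon_cases m. Qed.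

Lemma sublatticeP x : in_class 0 x -> exists p, x = sublattice p.
Proof.
case: x => a b; rewrite /in_class /= => ab.
exists (((2 * a + b) %/ 3)%Z, ((b - a) %/ 3)%Z).
by apply/eqP; rewrite xpair_eqE /= !mulr2n; lia.
Qed.

Lemma in_class_sublattice p : in_class 0 (sublattice p).
Proof. by case: p => a b; rewrite /in_class /= mulr2n; lia. Qed.

Section DoubleHexagonTilings.
Variable R : realType.
Implicit Types (u v w z rho : R[i]) (j m n k : nat) (h : hexagon R).
Implicit Types (p q x : lattice) (t : double_hexagon R).

Local Notation zeta := (zeta R).

Lemma lattice_point_sublattice p : lattice_point R (sublattice p) = (1 + zeta) * lattice_point R p.
Proof.
rewrite mulrDl mul1r /lattice_point eisM_zeta eisD /=; congr eis;
  rewrite !rmorphD ?rmorphN ?rmorphMn /=; ring.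
Qed.

Lemma inner_spoke t : is_double_hexagon t ->
  exists j, spoke (outer t) * zeta ^+ j = spoke (inner t) * (1 + zeta).
Proof.
case=> _ [k E] _; exists (k + 2)%N.
(* The quarter turn by which the outer hexagon is related to the inner one scaled by
   [sqrt 3] becomes a multiplication by [1 + zeta], up to a power of [zeta]. *)
have i3 : 'i%C * (Num.sqrt 3%:R)%:C = zeta * (1 + zeta) :> R[i].
  have z2 := zeta_sq R; rewrite mulrDr mulr1 z2 /zeta.
  by apply/eqP; rewrite eq_complex /=; apply/andP; split; apply/eqP; field.
apply: (mulfI (zeta_neq0 R)).
have -> : zeta * (spoke (outer t) * zeta ^+ (k + 2)) = spoke (outer t) * zeta ^+ k * zeta ^+ 3.
  by rewrite exprD [zeta ^+ 3]exprS; ring.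
have -> : zeta * (spoke (inner t) * (1 + zeta)) = zeta * (1 + zeta) * spoke (inner t) by ring.
rewrite -i3 -(mulrA 'i%C) E zeta3; have := sqr_i R; rewrite expr2 => ii.
rewrite !mulrA ii; ring.
Qed.

Lemma orientationE h : orientation h = spoke h * (zeta - 1).
Proof.
rewrite /orientation /arrow_vector /arrow /= /vertex expr1 expr0; ring.
Qed.

(** Stripes are perpendicular to orientations.  In terms of directions, the outer
    stripe lies along [(1 + zeta) ^+ 2 * zeta ^+ j'], which has to be perpendicular to
    the inner one, along [(1 + zeta) * zeta ^+ j]. *)
Lemma perpendicular_stripes t rho j j' : is_double_hexagon t -> rho != 0 ->
  spoke (inner t) = rho * zeta ^+ j -> spoke (outer t) = rho * (1 + zeta) * zeta ^+ j' ->
  j' = (j + 1)%N %[mod 3].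
Proof.
case=> _ _; rewrite !orientationE => perp rho0 sE sE'; move: perp; rewrite sE sE'.
set k := ((j' + 5 * j) %% 6)%N.
rewrite (zeta_split R j' j) -/k.
have -> : rho * (1 + zeta) * (zeta ^+ j * zeta ^+ k) * (zeta - 1) =
    rho * zeta ^+ j * (zeta - 1) * (zeta ^+ k * (1 + zeta)) by ring.
rewrite -[X in dot X _]mulr1 dotM => /eqP; rewrite mulf_eq0 gt_eqF /=; last first.
  by rewrite dot_gt0 // !mulf_neq0 ?expf_neq0 ?zeta_neq0 ?zetaB1_neq0.
have -> : 1 = eis 1 0 :> R[i] by rewrite /eis rmorph0 rmorph1; ring.
have -> : eis 1 0 + zeta = eis 1 1 :> R[i] by rewrite /eis rmorph0 rmorph1; ring.
have kE : (k = j' + 5 * j %[mod 3])%N by rewrite modn_dvdm.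
case: k kE (ltn_pmod (j' + 5 * j) (isT : 0 < 6)%N : (k < 6)%N) => [|[|[|[|[|[|]]]]]] // kE _;
  rewrite ?exprS expr0 ?mulr1 -?mulrA ?mul1r ?eisM_zeta dot_eis => /eqP X;
  first [clear -kE; lia|exfalso; clear -X; lra].
Qed.

(** The centres of the small hexagons. *)
Definition site (o rho : R[i]) x : R[i] := o + rho * (1 + zeta) * lattice_point R x.

Lemma site_inj o rho : rho != 0 -> injective (site o rho).
Proof.
move=> rho0 x y /addrI/mulfI - /(_ _)/lattice_point_inj; apply.
by rewrite mulf_neq0 ?zeta1_neq0.
Qed.

Lemma siteD_unit o rho x m :
  site o rho (x + unit_vector m) = site o rho x + rho * (1 + zeta) * zeta ^+ m.
Proof. by rewrite /site lattice_pointD lattice_point_unit mulrDr addrA. Qed.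

(** The tiling [T] put on the lattice: [rho] is the spoke of a small hexagon, and the
    turns say by how many sixths of a turn the labelled hexagons are rotated. *)
Record coordinates (T : set (double_hexagon R)) (o rho : R[i])
    (tile : lattice -> double_hexagon R) (inner_turn outer_turn : lattice -> nat) : Prop :=
  Coordinates {
    coord_scale : rho != 0;
    coord_tile p : T (tile p);
    coord_surj t : T t -> exists p, t = tile p;
    coord_outer_centre p : centre (outer (tile p)) = site o rho (sublattice p);
    coord_inner_centre p : centre (inner (tile p)) = site o rho (sublattice p);
    coord_outer_spoke p : spoke (outer (tile p)) = rho * (1 + zeta) * zeta ^+ outer_turn p;
    coord_inner_spoke p : spoke (inner (tile p)) = rho * zeta ^+ inner_turn p;
    coord_turns p : outer_turn p = (inner_turn p + 1)%N %[mod 3] }.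

Lemma coordinates_exist T : double_hexagon_tiling T ->
  exists o rho tile inner_turn outer_turn,
    coordinates T o rho tile inner_turn outer_turn.
Proof.
move=> [dT tiling]; have [_ /(_ 0)[t0 Tt0 _] _] := tiling.
set S := spoke (outer t0); pose rho := S / (1 + zeta).
have SE : S = rho * (1 + zeta) by rewrite divfK // zeta1_neq0.
have S0 : S != 0 := spoke_neq0 tiling Tt0.
have rho0 : rho != 0 by move: S0; rewrite SE mulf_eq0 negb_or => /andP[].
have /choice[tile tileP] p : exists t, T t /\ centre (outer t) = tile_site (@outer R) t0 p /\
    (exists j, spoke (outer t) = S * zeta ^+ j).
  by have [t [? ? ?]] := tile_at_site tiling Tt0 p; exists t.
have Tt p : T (tile p) by case: (tileP p).
have siteE p : tile_site (@outer R) t0 p = site (centre (outer t0)) rho (sublattice p).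
  by rewrite /tile_site -/S SE /site lattice_point_sublattice; ring.
have ct p : centre (outer (tile p)) = site (centre (outer t0)) rho (sublattice p).
  by rewrite -siteE; case: (tileP p) => _ [].
have /choice[Jo JoP] p : exists j, spoke (outer (tile p)) = S * zeta ^+ j.
  by case: (tileP p) => _ [].
have /choice[Ji JiP] p : exists j, spoke (inner (tile p)) = rho * zeta ^+ j.
  have [j jE] := inner_spoke (dT _ (Tt p)); exists (Jo p + j)%N.
  apply: (mulIf (zeta1_neq0 R)); rewrite -jE JoP SE exprD; ring.
exists (centre (outer t0)), rho, tile, Ji, Jo; split=> //.
- move=> t Ttt; have [p cp] := tile_has_site tiling Tt0 Ttt.
  exists p; apply: (tile_of_centre tiling) => //.
  by rewrite ct -siteE -cp; exact: centre_region.
- by move=> p; have [-> _ _] := dT _ (Tt p).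
- by move=> p; rewrite JoP SE.
- move=> p; apply: (perpendicular_stripes (dT _ (Tt p)) rho0 (JiP p)).
  by rewrite JoP SE.
Qed.

(** The midpoint of the side of the unit hexagon that faces [1 + zeta] is halfway to
    that point, at distance [sqrt 3 / 2]; all points of the other sides are farther. *)
Lemma nearest_side (r : nat) (a : R) : (r < 6)%N -> 0 <= a -> a <= 1 ->
  dot (zeta ^+ r * eis (1 - a) a - eis 1 1) (zeta ^+ r * eis (1 - a) a - eis 1 1) <=
    dot (eis 2^-1 2^-1 - eis 1 1) (eis 2^-1 2^-1 - eis 1 1 : R[i]) ->
  r = 0%N.
Proof.
case: r => [|[|[|[|[|[|]]]]]] // _ a0 a1;
  rewrite ?exprS expr0 ?mulr1 -?mulrA ?mul1r ?eisM_zeta !eisN !eisD !dot_eis => le;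
  exfalso; nra.
Qed.

Section Sites.
Variables (T : set (double_hexagon R)) (o rho : R[i]).
Variables (tile : lattice -> double_hexagon R) (inner_turn outer_turn : lattice -> nat).
Hypothesis legalT : legal T.
Hypothesis coord : coordinates T o rho tile inner_turn outer_turn.
Let rho0 : rho != 0 := coord_scale coord.

Lemma closest_sideE p n (k : 'I_6) :
  closest_side (inner (tile p)) k (site o rho (sublattice p + unit_vector n)) ->
  k = side_towards (inner_turn p) n.
Proof.
set h := inner (tile p); set v := site _ _ _; set j := side_towards _ _ => close.
have sE : spoke h = rho * zeta ^+ inner_turn p := coord_inner_spoke coord p.
have vE : v = centre h + rho * zeta ^+ n * eis 1 1.
  rewrite /v siteD_unit /h (coord_inner_centre coord) /eis !rmorph1; ring.
pose z := centre h + rho * zeta ^+ n * eis 2^-1 2^-1.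
have zj : side h j z.
  rewrite (side_towardsE _ sE) exprD; exists 2^-1; split; [lra|lra|].
  rewrite /z /eis; have -> : (2^-1 : R)%:C = 2^-1 by rewrite fmorphV rmorph_nat.
  by field.
have [z' /side_coords[t [t0 t1 z'E]] le_len] := close j z zj.
set r := ((inner_turn p + k + 5 * n) %% 6)%N.
have zr : zeta ^+ inner_turn p * zeta ^+ k = zeta ^+ n * zeta ^+ r :> R[i].
  by rewrite -exprD (zeta_split _ _ n).
have : dot (z' - v) (z' - v) <= dot (z - v) (z - v).
  by move: le_len; rewrite /len ler_sqrt // /dot -!expr2 addr_ge0 ?sqr_ge0.
have -> : z' - v = rho * zeta ^+ n * (zeta ^+ r * eis (1 - t) t - eis 1 1).
  rewrite z'E vE sE -(mulrA rho) zr; ring.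
have -> : z - v = rho * zeta ^+ n * (eis 2^-1 2^-1 - eis 1 1) by rewrite /z vE; ring.
rewrite !(dotM (rho * zeta ^+ n)) ler_pM2l ?dot_gt0 ?mulf_neq0 ?expf_neq0 ?zeta_neq0 // => dot_le.
have r_0 : r = 0%N by apply: nearest_side dot_le; rewrite ?ltn_mod.
apply: val_inj; rewrite /= inordK ?ltn_mod //.
by have := ltn_ord k; move: r_0; rewrite /r; lia.
Qed.

Lemma inner_arrow p x m : sublattice p = x + unit_vector m ->
  arrow (inner (tile p)) (side_towards (inner_turn p) (m + 3)) =
    let v := site o rho x in
    if ccw (inner_turn p) (m + 3) then (v + rho * zeta ^+ (m + 1), v + rho * zeta ^+ m)
    else (v + rho * zeta ^+ m, v + rho * zeta ^+ (m + 1)).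
Proof.
move=> px; rewrite (arrow_towards _ (coord_inner_spoke coord p)).
rewrite (coord_inner_centre coord) px siteD_unit.
have -> : site o rho x + rho * (1 + zeta) * zeta ^+ m + rho * zeta ^+ (m + 3) =
    site o rho x + rho * zeta ^+ (m + 1) by rewrite zetaD3 exprD expr1; ring.
have -> : site o rho x + rho * (1 + zeta) * zeta ^+ m + rho * zeta ^+ (m + 3 + 1) =
    site o rho x + rho * zeta ^+ m by rewrite addnAC zetaD3 exprD expr1; ring.
by [].
Qed.

Lemma outer_vertex p x m : sublattice p = x + unit_vector m ->
  vertex (outer (tile p)) (side_towards (outer_turn p) (m + 3)) = site o rho x.
Proof.
move=> px; have := vertex_towards (m + 3) 0 (coord_outer_spoke coord p).
rewrite !addn0 (coord_outer_centre coord) px siteD_unit exprD zeta3 => ->; ring.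
Qed.

Lemma corner_arrow_inner x a : corner_arrow T (site o rho x) a ->
  exists p m, sublattice p = x + unit_vector m /\
    a = arrow (inner (tile p)) (side_towards (inner_turn p) (m + 3)).
Proof.
move=> [t [Tt [k kE] [k' close ->]]].
have [p tE] := coord_surj coord Tt; rewrite {t Tt}tE in kE close *.
pose n := (outer_turn p + k)%N.
have xE : x = sublattice p + unit_vector n.
  apply: (site_inj rho0 (o := o)); rewrite siteD_unit -kE /vertex.
  by rewrite (coord_outer_centre coord) (coord_outer_spoke coord) -mulrA -exprD.
exists p, (n + 3)%N; split.
  by rewrite xE unit_vectorN addrK.
rewrite -addnA; have -> : side_towards (inner_turn p) (n + (3 + 3)) = side_towards (inner_turn p) n.
  by rewrite /side_towards addnAC -[in LHS]modnDmr addn0.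
by rewrite (@closest_sideE p n k') // -xE.
Qed.

(** The unit vectors change the class by [1] and [-1] alternately. *)
Lemma alternate_neighbours x : ~~ in_class 0 x -> exists m,
  (forall i, in_class 0 (x + unit_vector (m + 2 * i))) /\
  forall n, in_class 0 (x + unit_vector n) ->
    exists2 i, (i < 3)%N & n = (m + 2 * i)%N %[mod 6].
Proof.
move=> x0.
have [m xm] : exists m, in_class 0 (x + unit_vector m).
  by case: (in_class_near 0 x 0) => xm; [rewrite xm in x0|exists 0%N|exists 1%N].
exists m; split=> [i|n].
  by move: xm; rewrite !in_class_unit oddD oddM /= addbF.
move: x0 xm; rewrite !in_class_unit /in_class !subr0 => x0 xm xn.
have mn : odd m = odd n by move: x0 xm xn; case: (odd m); case: (odd n) => //=; lia.
exists (((n + 5 * m) %/ 2) %% 3)%N; first by rewrite ltn_mod.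
have := odd_double_half m; have := odd_double_half n; rewrite mn -!muln2; lia.
Qed.

Lemma cross_unit v m (b : bool) :
  let a := if b then (v + rho * zeta ^+ m, v + rho * zeta ^+ (m + 1))
           else (v + rho * zeta ^+ (m + 1), v + rho * zeta ^+ m) in
  if b then 0 < cross (a.1 - v) (a.2 - v) else cross (a.1 - v) (a.2 - v) < 0.
Proof.
have rm : 0 < dot (rho * zeta ^+ m) (rho * zeta ^+ m).
  by rewrite dot_gt0 // mulf_neq0 ?expf_neq0 ?zeta_neq0.
have -> : rho * zeta ^+ (m + 1) = rho * zeta ^+ m * zeta by rewrite exprD mulrA.
have vK w : v + w - v = w by rewrite addrC addKr.
move: rm; move: (rho * zeta ^+ m) => c c0; case: b; rewrite /= !vK.
  have := crossM c 1 zeta; rewrite mulr1 => ->.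
  by rewrite pmulr_rgt0 // /cross /= mul0r subr0 mul1r divr_gt0 ?sqrtr_gt0.
have := crossM c zeta 1; rewrite mulr1 => ->.
by rewrite pmulr_rlt0 // /cross /= mulr0 sub0r mulr1 oppr_lt0 divr_gt0 ?sqrtr_gt0.
Qed.

(** At a site outside the class of the tiles the corner hexagon is wanted. *)
Lemma small_hexagon_at x : exists h j,
  [/\ small_hexagon T h, centre h = site o rho x & spoke h = rho * zeta ^+ j].
Proof.
have [_ _ mixed _] := legalT.
have [/sublatticeP[p ->]|/alternate_neighbours[m [nearx near_only]]] := boolP (in_class 0 x).
  exists (inner (tile p)), (inner_turn p); split.
  - by left; exists (tile p) => //; exact: coord_tile coord p.
  - exact: coord_inner_centre coord p.
  - exact: coord_inner_spoke coord p.
have /choice[P PE] i : exists p, sublattice p = x + unit_vector (m + 2 * i).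
  by have [p ->] := sublatticeP (nearx i); exists p.
set v := site o rho x.
have tv : tiling_vertex T v.
  exists (tile (P 0%N)); first exact: coord_tile coord _.
  by eexists; exact: outer_vertex (PE 0%N).
(* The sense of the arrow as seen from [v], opposite to that seen from the tile. *)
pose s i := ~~ ccw (inner_turn (P i)) (m + 2 * i + 3).
have arrows a : corner_arrow T v a -> exists2 i, (i < 3)%N &
    a = if s i then (v + rho * zeta ^+ (m + 2 * i), v + rho * zeta ^+ (m + 2 * i + 1))
        else (v + rho * zeta ^+ (m + 2 * i + 1), v + rho * zeta ^+ (m + 2 * i)).
  move=> /corner_arrow_inner[p [n [pE ->]]].
  have [i i3 ni] : exists2 i, (i < 3)%N & n = m + 2 * i %[mod 6].
    by apply: near_only; rewrite -pE in_class_sublattice.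
  exists i => //; have pP : p = P i.
    by apply: sublattice_inj; rewrite PE pE; congr (_ + _); exact: unit_vector_mod.
  have -> : side_towards (inner_turn p) (n + 3) =
      side_towards (inner_turn p) (m + 2 * i + 3).
    by rewrite /side_towards -(addnA n) -(addnA (m + 2 * i)) -(modnDml n) ni modnDml.
  by rewrite pP (inner_arrow (PE i)) /s -/v /=; case: (ccw _ _).
have [not_ccw not_cw] := mixed v tv.
have [j jE] : exists j, forall i, (i < 3)%N -> ccw j (m + 2 * i) = s i.
  apply: ccw_complete => all_s; [apply: not_ccw|apply: not_cw] => a /arrows[i i3 ->].
    by have := cross_unit v (m + 2 * i) (s i); rewrite all_s.
  by have := cross_unit v (m + 2 * i) (s i); rewrite (negPf (all_s i i3)).
exists (Hexagon v (rho * zeta ^+ j)), j; split => //; right; split => //= a /arrows[i i3 ->].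
exists (side_towards j (m + 2 * i)).
by rewrite (@arrow_towards _ _ rho j) // jE.
Qed.

Section Colouring.
Variables (small : lattice -> hexagon R) (turn : lattice -> nat).
Hypothesis small_in : forall x, small_hexagon T (small x).
Hypothesis small_centre : forall x, centre (small x) = site o rho x.
Hypothesis small_spoke : forall x, spoke (small x) = rho * zeta ^+ turn x.

Let d x := (turn x %% 3)%N.

Lemma small_adjacent h j x m : small_hexagon T h -> centre h = site o rho x ->
  spoke h = rho * zeta ^+ j ->
  ccw (turn (x + unit_vector m)) (m + 3) = ~~ ccw j m.
Proof.
move=> Th ch sh; have [_ _ _ wm] := legalT.
apply: (adjacent_arrows wm Th (small_in _) rho0 sh (small_spoke _)).
by rewrite small_centre siteD_unit ch exprD expr1; ring.
Qed.

(** The small hexagon chosen at the site of a tile has the same neighbours as the inner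
    hexagon of the tile, hence the same arrows. *)
Lemma ccw_inner p m : ccw (turn (sublattice p)) m = ccw (inner_turn p) m.
Proof.
apply: negb_inj; rewrite -(small_adjacent _ (small_in _) (small_centre _) (small_spoke _)).
apply: small_adjacent; last exact: (coord_inner_spoke coord).
  by left; exists (tile p) => //; exact: coord_tile coord p.
exact: coord_inner_centre coord p.
Qed.

Lemma colour_inner p : d (sublattice p) = (inner_turn p %% 3)%N.
Proof. by apply: (@ccw_determined _ _ 0) => i _; exact: ccw_inner. Qed.

Lemma small_alternating : alternating_colouring 0 d.
Proof.
have [_ wm _ wm'] := legalT; split=> [x|x m|x m].
- by rewrite ltn_mod.
- exact: (arrows_alternate wm' rho0 small_in small_centre small_spoke).
case/sublatticeP => p ->{x} w n wm0 n0 dw between.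
have rho1 : rho * (1 + zeta) != 0 by rewrite mulf_neq0 ?zeta1_neq0.
have outer_in q : ((@outer R) @` T)%classic (outer (tile q)).
  by exists (tile q) => //; exact: coord_tile coord q.
have outer_c q : centre (outer (tile q)) = o + rho * (1 + zeta) * (1 + zeta) * lattice_point R q.
  by rewrite (coord_outer_centre coord) /site lattice_point_sublattice mulrA.
have step i : sublattice p + normal_vector m *+ i = sublattice (p + unit_vector (m + 1) *+ i).
  by rewrite sublatticeD sublatticeMn sublattice_unit -addnA.
have dE q : (outer_turn q %% 3 = (d (sublattice q) + 1) %% 3)%N.
  by rewrite colour_inner modnDml (coord_turns coord).
have := @arrows_alternate _ _ _ _ _ _ wm rho1 outer_in outer_c (coord_outer_spoke coord)
  p (m + 1)%N ((w + 1) %% 3)%N n.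
have w3 : (w < 3)%N by rewrite -dw ltn_mod.
rewrite step !dE dw => alt; apply: contraNneq (alt _ n0 erefl _) => [->//||i i_n].
  by move: wm0 w3; clear; lia.
by rewrite dE -step between // modnDml.
Qed.

(** At the sites of tiles the inner hexagons are translated; elsewhere the arrows
    received from the three neighbouring tiles determine the colour. *)
Lemma colour_period z : (translate_double_hexagon z @` T = T)%classic ->
  exists q, z = rho * (1 + zeta) * lattice_point R q /\ forall x, d (x + q) = d x.
Proof.
move=> zT; have [[dT tiling] _ _ _] := legalT.
have moved t : T t -> T (translate_double_hexagon z t) by move=> Tt; rewrite -zT; exists t.
have [q0 q0E] := coord_surj coord (moved _ (coord_tile coord 0)).
pose q := sublattice q0; exists q.
have zE : z = rho * (1 + zeta) * lattice_point R q.
  apply: (addrI (centre (outer (tile 0)))).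
  rewrite -[LHS]/(centre (outer (translate_double_hexagon z (tile 0)))) q0E.
  rewrite !(coord_outer_centre coord) /site (_ : sublattice 0 = 0) //.
  by rewrite lattice_point0 mulr0 addr0.
split=> // x.
have inner_period p : inner_turn (p + q0) = inner_turn p %[mod 6].
  have [p1 p1E] := coord_surj coord (moved _ (coord_tile coord p)).
  have p1q : p1 = p + q0.
    apply/sublattice_inj/(site_inj rho0 (o := o)).
    rewrite -(coord_outer_centre coord) -p1E /= (coord_outer_centre coord).
    by rewrite sublatticeD /site lattice_pointD zE; ring.
  apply: unit_vector_inj; apply: (@lattice_point_inj R).
  rewrite !lattice_point_unit; apply: (mulfI rho0).
  by rewrite -!(coord_inner_spoke coord) -p1q -p1E.
have ccw_period p m : ccw (turn (sublattice p + q)) m = ccw (turn (sublattice p)) m.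
  rewrite -sublatticeD !ccw_inner /ccw -modnDmr -modnMmr inner_period.
  by rewrite modnMmr modnDmr.
have [/sublatticeP[p ->]|/alternate_neighbours[m [nearx _]]] := boolP (in_class 0 x).
  by apply: (@ccw_determined _ _ 0) => i _; exact: ccw_period.
apply: (@ccw_determined _ _ m) => i _; have [p pE] := sublatticeP (nearx i).
apply: negb_inj.
rewrite -!(small_adjacent _ (small_in _) (small_centre _) (small_spoke _)).
by rewrite addrAC pE ccw_period.
Qed.
End Colouring.
End Sites.

Theorem legal_aperiodic (T : set (double_hexagon R)) : legal T -> aperiodic T.
Proof.
move=> legalT z zT; have [dT _ _ _] := legalT.
have [o [rho [tile [inner_turn [outer_turn coord]]]]] := coordinates_exist dT.
have /choice[small /choice[turn smallP]] := small_hexagon_at legalT coord.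
have small_in x : small_hexagon T (small x) by case: (smallP x).
have small_centre x : centre (small x) = site o rho x by case: (smallP x).
have small_spoke x : spoke (small x) = rho * zeta ^+ turn x by case: (smallP x).
have [q [-> period]] := colour_period legalT coord small_in small_centre small_spoke zT.
have alternating_d := small_alternating legalT coord small_in small_centre small_spoke.
rewrite (colouring_aperiodic alternating_d period).
by rewrite lattice_point0 mulr0.
Qed.
End DoubleHexagonTilings.

(* [eps] is less than half the side of the small hexagons, so that the marked
   points lie in the interiors of the sides. *)
Theorem proposition4p2 (R : realType) (T : set (double_hexagon R)) (eps : R)
  (heps : 0 < eps)
  (hsmall : forall h, small_hexagon T h -> eps < len (spoke h) / 2%:R)
  (hlegal : legal T)
  (hns : non_singular eps T) :
  aperiodic T.
Proof. exact: legal_aperiodic. Qed.
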